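(* Consider a spherical form MIQP $$\min \ y^{\mathsf T} D y + c^{\mathsf T} y + l^{\mathsf T} z \quad \text{s.t.}\quad (y,z)\in\mathcal P,\quad y\in\Lambda+\operatorname{span}(\Lambda)^\perp,\quad z\in\mathbb R^{n-d},$$ assume that there exist two aligned vectors for it, and let $k$ be the rank of the matrix $D$. For every $\epsilon\in(0,1]$, there is an algorithm that finds an $\epsilon$-approximate solution, if it exists, by solving at most $\left\lceil 4 r_d\sqrt{k/(3\epsilon)}\right\rceil^k$ mixed integer linear programming problems of the same size as the given spherical form MIQP and with $p$ integer variables.
   Context: Spherical form MIQP: an optimization problem of the form displayed in the claim, with variables $y\in\mathbb R^d$, $z\in\mathbb R^{n-d}$, where: $D\in\mathbb Q^{d\times d}$ is diagonal with $|D_{11}|\ge\cdots\ge|D_{dd}|$; $c\in\mathbb Q^d$, $l\in\mathbb Q^{n-d}$; $\Lambda$ is a lattice of rank $p$ and dimension $d$ (the set of integer linear combinations of $p$ linearly independent vectors of $\mathbb R^d$), given via a rational lattice basis; $\mathcal P\subseteq\mathbb R^n$ is a polytope given via a finite system of rational linear inequalities and satisfying $$\mathcal B(a,1)\subset\operatorname{proj}_y\mathcal P\subset\mathcal B(a,r_d),$$ where $\operatorname{proj}_y\mathcal P$ is the orthogonal projection of $\mathcal P$ onto the space $\mathbb R^d$ of the $y$ variables, $a$ is a given vector in $\mathbb Q^d$, $r_d$ is an integer of size polynomial in $d$, and $\mathcal B(a,r)=\{y\in\mathbb R^d:\|y-a\|\le r\}$ is the closed Euclidean ball. Here $\operatorname{span}(\Lambda)^\perp$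 is the orthogonal complement in $\mathbb R^d$ of the linear span of $\Lambda$. Aligned vectors: two vectors $y^+,y^-\in\mathbb R^d$ are aligned for the spherical form MIQP if $y^+,y^-\in\mathcal B(a,1)\cap(2\Lambda+\operatorname{span}(\Lambda)^\perp)$, $y^+_1-y^-_1\ge 1$, and $\sum_{i=2}^d(y^+_i-y^-_i)^2\le 1/4$. $\epsilon$-approximate solution: let $f$ be the objective function, assume there is an optimal solution $(y^*,z^* )$, and let $f_{\max}$ be the maximum of $f$ on the feasible region. A feasible point $(y^\diamond,z^\diamond)$ is an $\epsilon$-approximate solution if $f(y^\diamond,z^\diamond)-f(y^*,z^* )\le\epsilon\cdot(f_{\max}-f(y^*,z^* ))$. A mixed integer linear programming problem (MILP) minimizes a linear function over $\{x\in\mathbb Z^p\times\mathbb R^{n-p}:Wx\le w\}$ with rational data. *)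

(* Defs.v *)
From HB Require Import structures.
From mathcomp Require Import all_boot all_order all_algebra.
From mathcomp Require Import all_classical all_reals.

Set Implicit Arguments.
Unset Strict Implicit.
Unset Printing Implicit Defensive.

Import Order.TTheory GRing.Theory Num.Theory.
Local Open Scope classical_set_scope.
Local Open Scope ring_scope.

(** * Euclidean space, lattices *)

Section Geometry.
Variables (R : realType) (d : nat).
Implicit Types (x y u v : 'cV[R]_d) (A S : set 'cV[R]_d).

Definition dotp x y : R := \sum_i x i 0 * y i 0.

Definition ball2 (a : 'cV[R]_d) (r : R) : set 'cV[R]_d :=
  [set y | Num.sqrt (dotp (y - a) (y - a)) <= r].

Definition lin_span S : set 'cV[R]_d :=
  [set y | exists (h : nat) (s : 'I_h -> 'cV[R]_d) (t : 'I_h -> R),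
     (forall i, S (s i)) /\ y = \sum_i t i *: s i].

Definition orth_compl S : set 'cV[R]_d :=
  [set y | forall u, S u -> dotp y u = 0].

Definition minkowski A S : set 'cV[R]_d := [set u + v | u in A & v in S].

Definition dilate (t : R) S : set 'cV[R]_d := [set t *: u | u in S].

(* The columns of [B] are the lattice basis. *)
Definition lattice (p : nat) (B : 'M[rat]_(d, p)) : set 'cV[R]_d :=
  [set y | exists v : 'cV[int]_p, y = map_mx ratr B *m map_mx intr v].

End Geometry.

Definition polyhedron (R : realType) (m n : nat)
    (W : 'M[rat]_(m, n)) (w : 'cV[rat]_m) : set 'cV[R]_n :=
  [set x | forall i, (map_mx ratr W *m x) i 0 <= ratr (w i 0)].

Definition bounded_pts (R : realType) (n : nat) (S : set 'cV[R]_n) : Prop :=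
  exists M : R, forall x, S x -> forall i, `|x i 0| <= M.

(** * Spherical form MIQP
    The number [n] of variables is [d + e]: [y] has [d] and [z] has [e = n - d]
    entries, and [col_mx y z] is the point [(y, z)].  The polytope is
    [{x | W x <= w}], given by [m] inequalities. *)

Record miqp (d e p m : nat) := Miqp {
  qD : 'M[rat]_d;
  qc : 'cV[rat]_d;
  ql : 'cV[rat]_e;
  qB : 'M[rat]_(d, p);
  qW : 'M[rat]_(m, d + e);
  qw : 'cV[rat]_m;
  qa : 'cV[rat]_d }.

Section Miqp.
Variables (R : realType) (d e p m : nat) (I : miqp d e p m).

Definition polytope_of : set 'cV[R]_(d + e) := polyhedron (qW I) (qw I).

Definition proj_y (S : set 'cV[R]_(d + e)) : set 'cV[R]_d :=
  [set y | exists z : 'cV[R]_e, S (col_mx y z)].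

Definition center : 'cV[R]_d := map_mx ratr (qa I).

Definition spherical_form (r : nat) : Prop :=
  [/\ is_diag_mx (qD I),
      (forall i j : 'I_d, (i <= j)%N -> `|qD I j j| <= `|qD I i i|),
      \rank (qB I) = p,
      bounded_pts polytope_of
    & ball2 center 1 `<=` proj_y polytope_of /\
      proj_y polytope_of `<=` ball2 center r%:R].

(* [Lambda + span(Lambda)^perp] *)
Definition lattice_cyl : set 'cV[R]_d :=
  minkowski (lattice (qB I)) (orth_compl (lin_span (lattice (qB I)))).

(* [2 Lambda + span(Lambda)^perp] *)
Definition lattice2_cyl : set 'cV[R]_d :=
  minkowski (dilate 2 (lattice (qB I)))
            (orth_compl (lin_span (lattice (qB I)))).

Definition aligned (yp ym : 'cV[R]_d) : Prop :=
  [/\ (ball2 center 1 `&` lattice2_cyl) yp,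
      (ball2 center 1 `&` lattice2_cyl) ym,
      (exists i : 'I_d, i = 0%N :> nat /\ 1 <= yp i 0 - ym i 0)
    & \sum_(i < d | (0 < i)%N) (yp i 0 - ym i 0) ^+ 2 <= 4^-1].

Definition feasible (x : 'cV[R]_(d + e)) : Prop :=
  polytope_of x /\ lattice_cyl (usubmx x).

Definition objective (x : 'cV[R]_(d + e)) : R :=
  let y := usubmx x in let z := dsubmx x in
  (y^T *m map_mx ratr (qD I) *m y) 0 0
  + ((map_mx ratr (qc I))^T *m y) 0 0
  + ((map_mx ratr (ql I))^T *m z) 0 0.

Definition minimizer (x : 'cV[R]_(d + e)) : Prop :=
  feasible x /\ forall x', feasible x' -> objective x <= objective x'.

Definition maximizer (x : 'cV[R]_(d + e)) : Prop :=
  feasible x /\ forall x', feasible x' -> objective x' <= objective x.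

Definition eps_approx (eps : R) (x : 'cV[R]_(d + e)) : Prop :=
  feasible x /\
  exists xmin xmax, [/\ minimizer xmin, maximizer xmax &
    objective x - objective xmin <= eps * (objective xmax - objective xmin)].

End Miqp.

(** * Mixed integer linear programs
    minimize [obj^T x] s.t. [W x <= w], the first [mint] of the [mvars]
    variables being integer. *)

Record milp := Milp {
  mvars : nat;
  mint : nat;
  mrows : nat;
  mobj : 'cV[rat]_mvars;
  mW : 'M[rat]_(mrows, mvars);
  mw : 'cV[rat]_mrows }.

Inductive milp_answer (n : nat) :=
  | Optimal of 'cV[rat]_n
  | Infeasible
  | Unbounded.
Arguments Infeasible {n}.
Arguments Unbounded {n}.

Section MilpSpec.
Variables (R : realType) (Q : milp).

Definition milp_feasible (x : 'cV[R]_(mvars Q)) : Prop :=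
  polyhedron (mW Q) (mw Q) x /\
  forall i : 'I_(mvars Q), (i < mint Q)%N -> x i 0 \is a Num.int.

Definition milp_value (x : 'cV[R]_(mvars Q)) : R :=
  ((map_mx ratr (mobj Q))^T *m x) 0 0.

Definition milp_answer_ok (ans : milp_answer (mvars Q)) : Prop :=
  match ans with
  | Optimal x =>
      let x : 'cV[R]_(mvars Q) := map_mx ratr x in
      milp_feasible x /\
      forall x', milp_feasible x' -> milp_value x <= milp_value x'
  | Infeasible => forall x, ~ milp_feasible x
  | Unbounded => forall M : R, exists2 x, milp_feasible x & milp_value x < M
  end.

End MilpSpec.

(* A MILP solver.  A rational MILP is infeasible, or unbounded, or attains its
   minimum at a rational point, so that a correct solver exists. *)
Definition milp_solver := forall Q : milp, milp_answer (mvars Q).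

Definition solver_ok (R : realType) (O : milp_solver) : Prop :=
  forall Q, milp_answer_ok R (O Q).

(** * Binary encoding sizes (Schrijver's conventions) *)

(* [up_log 2 h.+1] is the ceiling of [log_2 (h + 1)]. *)
Definition nat_size (h : nat) : nat := (1 + up_log 2 h.+1)%N.

Definition rat_size (x : rat) : nat :=
  (1 + up_log 2 `|numq x|.+1 + up_log 2 `|denq x|.+1)%N.

Definition mx_size (m n : nat) (A : 'M[rat]_(m, n)) : nat :=
  (m * n + \sum_i \sum_j rat_size (A i j))%N.

Definition miqp_size (d e p m : nat) (I : miqp d e p m) : nat :=
  (1 + mx_size (qD I) + mx_size (qc I) + mx_size (ql I) + mx_size (qB I)
   + mx_size (qW I) + mx_size (qw I) + mx_size (qa I))%N.

Definition milp_size (Q : milp) : nat :=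
  (1 + mx_size (mobj Q) + mx_size (mW Q) + mx_size (mw Q))%N.

(* An integer [r d], depending on [d], of size polynomial in [d]. *)
Definition poly_sized (r : nat -> nat) : Prop :=
  exists q : {poly nat}, forall d, (nat_size (r d) <= q.[d])%N.

(** * Algorithms
    A small imperative language with a MILP-solving instruction.  The memory
    has two sorts of arrays: natural numbers [N[a, i]], for sizes, indices and
    loop bounds, and rationals [Q[a, i, j]], for the numerical data.  Rationals
    are only used in field operations, comparisons and MILPs; they are never
    converted to naturals, and each loop has its number of iterations, a
    natural, fixed on entry.  So a program always terminates, and the number of
    elementary steps is bounded in terms of the natural inputs alone (the
    dimensions and the radius): enumerating the lattice points of a region, for
    instance, is not available, and MILPs have to be solved by the solver. *)

Inductive nexp :=
  | NConst of nat
  | NGet of nat & nexp              (* N[a, i] *)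
  | NAdd of nexp & nexp
  | NSub of nexp & nexp             (* truncated *)
  | NMul of nexp & nexp
  | NDiv of nexp & nexp
  | NMod of nexp & nexp.

Inductive qexp :=
  | QConst of rat
  | QNat of nexp
  | QGet of nat & nexp & nexp       (* Q[a, i, j] *)
  | QAdd of qexp & qexp
  | QOpp of qexp
  | QMul of qexp & qexp
  | QInv of qexp.                   (* the inverse of 0 is 0 *)

(* The tolerance [eps] is an arbitrary real number; a program accesses it
   through the test [BEps s t], which decides whether [s <= eps * t]. *)
Inductive bexp :=
  | BLeN of nexp & nexp
  | BLeQ of qexp & qexp
  | BEps of qexp & qexp
  | BNot of bexp
  | BAnd of bexp & bexp.

Inductive cmd :=
  | Skip
  | SetN of nat & nexp & nexp              (* N[a, i] := v *)
  | SetQ of nat & nexp & nexp & qexp       (* Q[a, i, j] := v *)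
  | Seq of cmd & cmd
  | If of bexp & cmd & cmd
  | Loop of nexp & cmd
  | Solve of nexp & nexp & nexp & nat & nat & nat & nat.

(* [calls] records the MILPs solved so far. *)
Record state := State {
  nmem : nat -> nat -> nat;
  qmem : nat -> nat -> nat -> rat;
  calls : seq milp }.

Definition set_nmem (s : state) (a i v : nat) : state :=
  State (fun a' i' => if (a' == a) && (i' == i) then v else nmem s a' i')
        (qmem s) (calls s).

Definition set_qmem (s : state) (a i j : nat) (v : rat) : state :=
  State (nmem s)
        (fun a' i' j' =>
           if [&& a' == a, i' == i & j' == j] then v else qmem s a' i' j')
        (calls s).

Fixpoint neval (s : state) (t : nexp) : nat :=
  match t with
  | NConst v => v
  | NGet a i => nmem s a (neval s i)
  | NAdd t1 t2 => neval s t1 + neval s t2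
  | NSub t1 t2 => neval s t1 - neval s t2
  | NMul t1 t2 => neval s t1 * neval s t2
  | NDiv t1 t2 => neval s t1 %/ neval s t2
  | NMod t1 t2 => neval s t1 %% neval s t2
  end%N.

Fixpoint qeval (s : state) (t : qexp) : rat :=
  match t with
  | QConst v => v
  | QNat u => (neval s u)%:R
  | QGet a i j => qmem s a (neval s i) (neval s j)
  | QAdd t1 t2 => qeval s t1 + qeval s t2
  | QOpp t1 => - qeval s t1
  | QMul t1 t2 => qeval s t1 * qeval s t2
  | QInv t1 => (qeval s t1)^-1
  end.

(* Entry access for matrices of arbitrary dimensions, 0 out of range. *)
Definition mx_entry (m n : nat) (A : 'M[rat]_(m, n)) (i j : nat) : rat :=
  match insub i, insub j with
  | Some i', Some j' => A i' j'
  | _, _ => 0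
  end.

Section Run.
Variables (R : realType) (eps : R) (O : milp_solver).

Fixpoint beval (s : state) (b : bexp) : bool :=
  match b with
  | BLeN t1 t2 => (neval s t1 <= neval s t2)%N
  | BLeQ t1 t2 => qeval s t1 <= qeval s t2
  | BEps t1 t2 => ratr (qeval s t1) <= eps * ratr (qeval s t2)
  | BNot b1 => ~~ beval s b1
  | BAnd b1 b2 => beval s b1 && beval s b2
  end.

(* The MILP with [n] variables, [p] of them integer, and [m] rows stored in the
   arrays [ao] (objective), [aW] and [aw] (constraints) is given to the solver;
   [N[ax, 0]] receives the status and [Q[ax, -, 0]] the optimal solution. *)
Definition solve_step (s : state) (n p m ao aW aw ax : nat) : state :=
  let Q := @Milp n p m (\col_i qmem s ao i 0)
             (\matrix_(i, j) qmem s aW i j) (\col_i qmem s aw i 0) in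
  let s' := State (nmem s) (qmem s) (rcons (calls s) Q) in
  match O Q with
  | Optimal x =>
      let s1 := set_nmem s' ax 0 1 in
      State (nmem s1)
            (fun a i j => if a == ax then mx_entry x i j else qmem s1 a i j)
            (calls s1)
  | Infeasible => set_nmem s' ax 0 0
  | Unbounded => set_nmem s' ax 0 2
  end.

Fixpoint run (c : cmd) (s : state) : state :=
  match c with
  | Skip => s
  | SetN a i t => set_nmem s a (neval s i) (neval s t)
  | SetQ a i j t => set_qmem s a (neval s i) (neval s j) (qeval s t)
  | Seq c1 c2 => run c2 (run c1 s)
  | If b c1 c2 => if beval s b then run c1 s else run c2 s
  | Loop t c1 => iter (neval s t) (run c1) s
  | Solve n p m ao aW aw ax =>
      solve_step s (neval s n) (neval s p) (neval s m) ao aW aw ax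
  end.

End Run.

(* Input: [N[0, -]] holds [d, e, p, m, r], and [Q[0, -, -], ..., Q[6, -, -]] hold
   [D, c, l, B, W, w, a]; all other cells are 0. *)
Definition init_state (d e p m : nat) (I : miqp d e p m) (r : nat) : state :=
  State
    (fun b i => if b == 0%N then nth 0%N [:: d; e; p; m; r] i else 0%N)
    (fun b => nth (fun _ _ => 0)
       [:: mx_entry (qD I); mx_entry (qc I); mx_entry (ql I); mx_entry (qB I);
           mx_entry (qW I); mx_entry (qw I); mx_entry (qa I)] b)
    [::].

(* Output: the point [(y, z)] is read in [Q[0, -, 0]]. *)
Definition output (R : realType) (n : nat) (s : state) : 'cV[R]_n :=
  \col_(i < n) ratr (qmem s 0 i 0).

(* Main.v *)
(** The nonzero diagonal entries of [D] are the first [k] ones.  Cut the range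
    [[a_i - r, a_i + r]] of each of the first [k] variables into [phi] intervals,
    where [phi] is the ceiling of [4 r sqrt (k / (3 eps))].  On each of the
    [phi ^ k] boxes, replacing [D_ii y_i^2] by its secant gives a linear
    objective, and changes differences of objective values by at most
    [sum_i |D_ii| (r / phi)^2 <= 3 eps |D_11| / 16].  If [yp], [ym] are aligned,
    their midpoint also lies in [Lambda + span(Lambda)^perp], and the second
    difference of the objective there is [(yp - ym)^T D (yp - ym) / 2], of absolute
    value at least [3 |D_11| / 8]; so the objective varies by at least
    [3 |D_11| / 16] on the feasible set, and the best of the MILP solutions is an
    [eps]-approximate solution.

    To have only [p] integer variables and no additional continuous one, the MILP
    is written in the coordinates of a basis of [R^(d+e)]: the [p] lattice vectors
    and the last columns of the inverse [X] of a matrix [M] which has the lattice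
    vectors as its first rows.  The latter columns span the orthogonal complement
    of the lattice.  The program computes [X] from the identity by [p] exchange
    steps, but its size is bounded through Cramer's rule, because the other
    entries of [M] are 0 or 1. *)

Require Import Defs.
From mathcomp Require Import all_boot all_order all_fingroup all_algebra.
From mathcomp Require Import all_classical all_reals.
From mathcomp Require Import zify ring lra.
From Stdlib Require List.

Set Implicit Arguments.
Unset Strict Implicit.
Unset Printing Implicit Defensive.

Import Order.TTheory GRing.Theory Num.Theory.
Local Open Scope ring_scope.

Arguments mx_entry : simpl never.

(** * Reasoning about programs *)

Fixpoint nwrites (c : cmd) : seq nat :=
  match c with
  | SetN a _ _ => [:: a]
  | Seq c1 c2 | If _ c1 c2 => nwrites c1 ++ nwrites c2
  | Loop _ c1 => nwrites c1
  | Solve _ _ _ _ _ _ ax => [:: ax]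
  | _ => [::]
  end.

Fixpoint qwrites (c : cmd) : seq nat :=
  match c with
  | SetQ a _ _ _ => [:: a]
  | Seq c1 c2 | If _ c1 c2 => qwrites c1 ++ qwrites c2
  | Loop _ c1 => qwrites c1
  | Solve _ _ _ _ _ _ ax => [:: ax]
  | _ => [::]
  end.

Fixpoint solves (c : cmd) : bool :=
  match c with
  | Seq c1 c2 | If _ c1 c2 => solves c1 || solves c2
  | Loop _ c1 => solves c1
  | Solve _ _ _ _ _ _ _ => true
  | _ => false
  end.

(** Frame condition for the two sorts of memory. The record of solved MILPs is left free and is
    followed separately by [run_calls]. *)
Definition same_off (wn wq : seq nat) (s s' : state) : Prop :=
  (forall b i, b \notin wn -> nmem s' b i = nmem s b i) /\
  (forall b i j, b \notin wq -> qmem s' b i j = qmem s b i j).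

Lemma same_off_refl wn wq s : same_off wn wq s s.
Proof. by split. Qed.

Lemma same_off_trans wn wq s1 s2 s3 :
  same_off wn wq s1 s2 -> same_off wn wq s2 s3 -> same_off wn wq s1 s3.
Proof.
move=> [n12 q12] [n23 q23]; split=> [b i nb|b i j nb].
- by rewrite n23 // n12.
- by rewrite q23 // q12.
Qed.

Lemma same_off_sub wn wq wn' wq' s s' :
  {subset wn <= wn'} -> {subset wq <= wq'} ->
  same_off wn wq s s' -> same_off wn' wq' s s'.
Proof.
move=> sn sq [n12 q12]; split=> [b i nb|b i j nb].
- by apply: n12; apply: contra nb; apply: sn.
- by apply: q12; apply: contra nb; apply: sq.
Qed.

Section Run.
Variables (R : realType) (eps : R) (O : milp_solver).
Local Notation run := (run eps O).

Lemma run_same_off c s : same_off (nwrites c) (qwrites c) s (run c s).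
Proof.
elim: c s => /= [|a i v|a i j v|c1 IH1 c2 IH2|b c1 IH1 c2 IH2|n c IH
  |n p m ao aW aw ax] s.
- exact: same_off_refl.
- by split=> //= b j; rewrite inE => /negPf ->.
- by split=> //= b i' j'; rewrite inE => /negPf ->.
- apply: (@same_off_trans _ _ _ (run c1 s)).
  + by apply: same_off_sub (IH1 s) => x xc; rewrite mem_cat xc.
  + by apply: same_off_sub (IH2 _) => x xc; rewrite mem_cat xc orbT.
- case: ifP => _.
  + by apply: same_off_sub (IH1 s) => x xc; rewrite mem_cat xc.
  + by apply: same_off_sub (IH2 _) => x xc; rewrite mem_cat xc orbT.
- elim: (neval s n) => [|k IHk] /=; first exact: same_off_refl.
  exact: same_off_trans IHk (IH _).
- rewrite /solve_step.
  case: (O _) => [x||]; split=> //= b i; rewrite inE.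
  + by move=> /negPf ->.
  + by move=> j /negPf ->.
  + by move=> /negPf ->.
  + by move=> /negPf ->.
Qed.

Lemma run_calls c s : ~~ solves c -> calls (run c s) = calls s.
Proof.
elim: c s => //= [c1 IH1 c2 IH2|b c1 IH1 c2 IH2|n c IH] s.
- by rewrite negb_or => /andP[n1 n2]; rewrite IH2 ?IH1.
- by rewrite negb_or => /andP[n1 n2]; case: ifP => _; [exact: IH1|exact: IH2].
- by move=> nc; elim: (neval s n) => //= k <-; rewrite IH.
Qed.

Lemma run_Seq c1 c2 s : run (Seq c1 c2) s = run c2 (run c1 s).
Proof. by []. Qed.

Lemma run_SetQ a i j v s :
  run (SetQ a i j v) s = set_qmem s a (neval s i) (neval s j) (qeval s v).
Proof. by []. Qed.

Lemma run_If b c1 c2 s :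
  run (If b c1 c2) s = if beval eps s b then run c1 s else run c2 s.
Proof. by []. Qed.

Definition For (v : nat) (n : nexp) (c : cmd) : cmd :=
  Seq (SetN v (NConst 0) (NConst 0))
    (Loop n (Seq c (SetN v (NConst 0)
                      (NAdd (NGet v (NConst 0)) (NConst 1))))).

Lemma nwrites_For v n c : nwrites (For v n c) =i v :: nwrites c.
Proof. by move=> x; rewrite /= !inE mem_cat inE; case: eqP; rewrite ?orbT ?orbF. Qed.

Lemma qwrites_For v n c : qwrites (For v n c) = qwrites c.
Proof. by rewrite /= cats0. Qed.

Lemma run_For (P : nat -> state -> Prop) v n c s N :
  v \notin nwrites c ->
  neval (set_nmem s v 0 0) n = N ->
  (forall i s' x, P i s' -> P i (set_nmem s' v 0 x)) ->
  P 0%N s ->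
  (forall i s', (i < N)%N -> same_off (v :: nwrites c) (qwrites c) s s' ->
     nmem s' v 0 = i -> P i s' -> P i.+1 (run c s')) ->
  P N (run (For v n c) s).
Proof.
move=> vc nN Pst P0 PS /=; rewrite nN.
set step := fun s : state => _.
suff: forall k, (k <= N)%N -> let s' := iter k step (set_nmem s v 0 0) in
  [/\ same_off (v :: nwrites c) (qwrites c) s s', nmem s' v 0 = k & P k s'].
  by move=> /(_ N (leqnn N))[].
elim=> [_ /=|k IH kN /=].
  split; last exact: Pst.
  - by split=> //= b i; rewrite inE negb_or => /andP[/negPf ->].
  - by rewrite !eqxx.
have [sk vk Pk] := IH (ltnW kN).
have sc := run_same_off c (iter k step (set_nmem s v 0 0)).
have vk' : nmem (run c (iter k step (set_nmem s v 0 0))) v 0 = k.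
  by rewrite (proj1 sc).
split.
- apply: same_off_trans sk _; split=> [b i|b i j].
  + rewrite inE negb_or => /andP[/negPf nb bc].
    by rewrite /step /= nb /= (proj1 sc).
  + by move=> bc; rewrite /step /= (proj2 sc).
- by rewrite /step /= !eqxx /= vk' addn1.
- by rewrite /step; apply: Pst; apply: PS.
Qed.

Definition SumQ (acc v : nat) (n : nexp) (e : qexp) : cmd :=
  Seq (SetQ acc (NConst 0) (NConst 0) (QConst 0))
      (For v n (SetQ acc (NConst 0) (NConst 0)
                  (QAdd (QGet acc (NConst 0) (NConst 0)) e))).

Lemma run_SumQ acc v n e s N (E : nat -> rat) :
  (forall s', same_off [:: v] [:: acc] s s' -> neval s' n = N) ->
  (forall s' i, same_off [:: v] [:: acc] s s' -> nmem s' v 0 = i -> (i < N)%N ->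
     qeval s' e = E i) ->
  qmem (run (SumQ acc v n e) s) acc 0 0 = \sum_(i < N) E i.
Proof.
move=> nN eE; rewrite /SumQ run_Seq run_SetQ.
set s0 := set_qmem _ _ _ _ _.
have s00 : same_off [:: v] [:: acc] s s0.
  by split=> //= b i j; rewrite inE => /negPf ->.
apply: (run_For (P := fun k s' => qmem s' acc 0 0 = \sum_(i < k) E i)) => //=.
- apply: nN; apply: same_off_trans s00 _; split=> //= b i.
  by rewrite inE => /negPf ->.
- by rewrite !eqxx big_ord0.
- move=> i s' iN ss' vi Pi; rewrite !eqxx /= Pi big_ord_recr /=; congr (_ + _).
  by apply: eE => //; apply: same_off_trans s00 ss'.
Qed.

(** Expressions have neither sums nor conditionals, so [c] may first compute an entry into a scratch
    cell, from which [e] reads it. *)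
Definition Fill (a v1 : nat) (n1 : nexp) (v2 : nat) (n2 : nexp)
    (c : cmd) (e : qexp) : cmd :=
  For v1 n1 (For v2 n2
    (Seq c (SetQ a (NGet v1 (NConst 0)) (NGet v2 (NConst 0)) e))).

Lemma run_Fill a v1 n1 v2 n2 c e s N1 N2 (E : nat -> nat -> rat) :
  let wn := [:: v1, v2 & nwrites c] in let wq := a :: qwrites c in
  v1 != v2 -> v1 \notin nwrites c -> v2 \notin nwrites c ->
  a \notin qwrites c ->
  (forall s', same_off wn wq s s' -> neval s' n1 = N1) ->
  (forall s', same_off wn wq s s' -> neval s' n2 = N2) ->
  (forall s' i j, same_off wn wq s s' -> (i < N1)%N -> (j < N2)%N ->
     nmem s' v1 0 = i -> nmem s' v2 0 = j -> qeval (run c s') e = E i j) ->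
  forall i j, qmem (run (Fill a v1 n1 v2 n2 c e) s) a i j =
    if (i < N1)%N && (j < N2)%N then E i j else qmem s a i j.
Proof.
move=> wn wq v12 v1c v2c ac nN1 nN2 eE; rewrite /Fill.
have so0 v : v \in wn -> same_off wn wq s (set_nmem s v 0 0).
  by move=> vw; split=> //= b i; case: eqP => // -> /negP.
have v1E : v1 \in wn by rewrite inE eqxx.
have v2E : v2 \in wn by rewrite !inE eqxx orbT.
apply: (run_For (P := fun k s' => forall i j, qmem s' a i j =
    if (i < k)%N && (j < N2)%N then E i j else qmem s a i j)) => //.
- by rewrite nwrites_For inE negb_or v12 /= cats0.
- exact/nN1/so0.
- move=> i s' iN1 ss' v1i Pi.
  have {}ss' : same_off wn wq s s'.
    apply: same_off_sub ss' => x.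
      by rewrite inE nwrites_For /= cats0 !inE.
    by rewrite qwrites_For mem_cat !inE orbC.
  (* Progress inside row [i]: the earlier rows are complete and this one is filled up to column
     [k]. *)
  pose P := fun k s2 => nmem s2 v1 0 = i /\ forall i' j, qmem s2 a i' j =
    if (i' < i)%N && (j < N2)%N || (i' == i) && (j < k)%N then E i' j
    else qmem s a i' j.
  suff : P N2 (run (For v2 n2
    (Seq c (SetQ a (NGet v1 (NConst 0)) (NGet v2 (NConst 0)) e))) s').
    move=> [_ P2] i' j; rewrite P2 ltnS (leq_eqVlt i').
    by case: (i' == i); case: (i' < i)%N; case: (j < N2)%N.
  apply: (run_For (P := P)) => //.
  + by rewrite /= cats0.
  + apply: nN2; apply: same_off_trans ss' _; split=> //= b i'.
    by case: eqP => // ->; rewrite v2E.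
  + by move=> k s2 x [P1 P2]; split; rewrite //= (negPf v12).
  + by split=> // i' j; rewrite ltn0 andbF orbF Pi.
  + move=> j s2 jN2 ss2 v2j [v1s2 P2].
    have {}ss2 : same_off wn wq s s2.
      apply: same_off_trans ss' _; apply: same_off_sub ss2 => x.
        by rewrite /= cats0 => xw; rewrite in_cons xw orbT.
      by rewrite mem_cat !inE orbC.
    have [sc1 sc2] := run_same_off c s2.
    split=> /=; first by rewrite sc1.
    move=> i' j'; rewrite !sc1 // v1s2 v2j eqxx /= sc2 // P2 ltnS (leq_eqVlt j').
    have [->|] /= := eqVneq i' i; rewrite ?andbF ?orbF //.
    have [->|] //= := eqVneq j' j.
    by rewrite orbT; apply: eE.
Qed.

End Run.

(** * The exchange algorithm *)

Lemma mxrank_diag (F : fieldType) n (A : 'M[F]_n) :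
  is_diag_mx A -> \rank A = (\sum_i (A i i != 0%R))%N.
Proof.
elim: n A => [|n IH] A dA; first by rewrite big_ord0 (thinmx0 A) mxrank0.
move: A dA; rewrite -[n.+1]/(1 + n)%N => A; rewrite -[A]submxK is_diag_block_mx //.
move=> /and4P[/eqP ur0 /eqP dl0 _ ddr].
rewrite ur0 dl0 rank_diag_block_mx (IH _ ddr) big_ord_recl; congr (_ + _)%N.
  have -> : @ord0 n = @lshift 1 n ord0 by apply: val_inj.
  rewrite block_mxEul rank_rV; congr (nat_of_bool (~~ _)).
  apply/eqP/eqP => [->|h]; first by rewrite mxE.
  by apply/matrixP => i j; rewrite !ord1 h mxE.
apply: eq_bigr => i _.
have -> : lift (@ord0 n) i = @rshift 1 n i by apply: val_inj.
by rewrite block_mxEdr.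
Qed.

Lemma mx_entryE (m n : nat) (A : 'M[rat]_(m, n)) (i : 'I_m) (j : 'I_n) :
  mx_entry A i j = A i j.
Proof. by rewrite /mx_entry !valK. Qed.

Lemma mx_entry_row0 (m n : nat) (A : 'M[rat]_(m, n)) i j :
  (m <= i)%N -> mx_entry A i j = 0.
Proof. by move=> mi; rewrite /mx_entry insubN // -leqNgt. Qed.

Section Exchange.
Variables (n : nat) (b : nat -> nat -> rat).
Implicit Types X : 'M[rat]_n.

(* That the other entries of [M] are 0 or 1 is all that the size bound on its
   inverse [X] needs; they are rows of a permutation matrix. *)
Definition exchanged (t : nat) X : Prop :=
  exists M : 'M[rat]_n, [/\ M *m X = 1%:M,
    (forall i j : 'I_n, (i < t)%N -> M i j = b j i)
    & (forall i j : 'I_n, (t <= i)%N -> (M i j == 0) || (M i j == 1))].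

(** As [M X = 1], these are the coordinates, in the basis of the rows of [M], of the vector with
    entries [b i t]. *)
Definition coords t X (l : 'I_n) : rat := \sum_(i < n) b i t * X i l.

Lemma exchanged0 : exchanged 0 1%:M.
Proof.
exists 1%:M; split=> // [|i j _]; first by rewrite mulmx1.
by rewrite mxE; case: (i == j); rewrite eqxx ?orbT.
Qed.

(** Swapping two columns of [X] swaps the same rows of [M]; both have index at least [t], so the
    rows already exchanged stay in place. *)
Lemma exchanged_swap t X (s r : 'I_n) :
  (t <= s)%N -> (t <= r)%N -> exchanged t X -> exchanged t (xcol s r X).
Proof.
move=> ts tr [M [MX Mt M01]]; exists (xrow s r M); split.
- rewrite xrowE xcolE -mulmxA (mulmxA M) MX mul1mx.
  by rewrite /tperm_mx -perm_mxM tperm2 perm_mx1.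
- move=> i j it; rewrite !mxE tpermD ?Mt //.
  + by apply: contraTneq it => <-; rewrite -leqNgt.
  + by apply: contraTneq it => <-; rewrite -leqNgt.
- move=> i j it; rewrite !mxE; apply: M01.
  by case: tpermP.
Qed.

(** Basis exchange: row [t] of [M] is replaced by the vector [b _ t]. In the inverse, column [t] is
    divided by the pivot, and a multiple of it is subtracted from every other column to make that
    column orthogonal to the new row. *)
Lemma exchanged_pivot X (t : 'I_n) : coords t X t != 0 -> exchanged t X ->
  exchanged t.+1 (\matrix_(i, l) (if l == t then X i t / coords t X t
                   else X i l - coords t X l * (X i t / coords t X t))).
Proof.
move=> bt0 [M [MX Mt M01]].
exists (\matrix_(i, j) if i == t then b j t else M i j).
split=> [|i j|i j]; last 2 first.
- rewrite ltnS leq_eqVlt mxE => /orP[/eqP/val_inj-> |it]; first by rewrite eqxx.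
  by rewrite ifN ?Mt //; apply: contraTneq it => ->; rewrite ltnn.
- move=> ti; rewrite mxE ifN ?M01 ?(ltnW ti) //.
  by apply: contraTneq ti => ->; rewrite ltnn.
have E i l : \sum_j M i j * X j l = (i == l)%:R.
  by have /matrixP/(_ i l) := MX; rewrite !mxE.
apply/matrixP => i l; rewrite !mxE.
have [->{i}|it] := eqVneq i t.
- under eq_bigr do rewrite !mxE eqxx.
  have [_|lt] := eqVneq l t.
  + under eq_bigr do rewrite mulrA.
    by rewrite -mulr_suml -/(coords t X t) divff.
  + under eq_bigr do rewrite mulrBr mulrCA.
    rewrite sumrB -/(coords t X l) -mulr_sumr.
    under [X in _ - _ * X]eq_bigr do rewrite mulrA.
    by rewrite -mulr_suml -/(coords t X t) divff // mulr1 subrr.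
- under eq_bigr do rewrite !mxE (negPf it).
  have [->|lt] := eqVneq l t.
  + under eq_bigr do rewrite mulrA.
    by rewrite -mulr_suml E (negPf it) mul0r.
  + under eq_bigr do rewrite mulrBr mulrCA.
    rewrite sumrB E -mulr_sumr.
    under [X in _ - _ * X]eq_bigr do rewrite mulrA.
    by rewrite -mulr_suml E (negPf it) mul0r mulr0 subr0.
Qed.

(* Bring the pivot column [s] to position [t], then pivot. *)
Lemma exchanged_step X (t s : 'I_n) : (t <= s)%N -> coords t X s != 0 ->
  exchanged t X ->
  exchanged t.+1 (\matrix_(i, l)
    (if l == t then X i s / coords t X s else
     let l' := if l == s then t else l in
     X i l' - coords t X l' * (X i s / coords t X s))).
Proof.
move=> ts bs0 ex.
have cE l : coords t (xcol s t X) l = coords t X (tperm s t l).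
  by apply: eq_bigr => i _; rewrite mxE.
have := @exchanged_pivot (xcol s t X) t; rewrite cE tpermR => /(_ bs0).
move=> /(_ (exchanged_swap ts (leqnn _) ex)).
congr (exchanged _ _); apply/matrixP => i l; rewrite !mxE tpermR cE.
have [//|lt] := eqVneq l t.
have [->|ls] /= := eqVneq l s; first by rewrite tpermL.
by rewrite tpermD // eq_sym.
Qed.

(** If all coordinates from [t] on vanished, column [t] of [b] would be a combination of the first
    [t] rows of [M], which are the earlier columns of [b], against independence. *)
Lemma coords_neq0 p t X : (forall v : nat -> rat,
    (forall i : 'I_n, \sum_(j < p) b i j * v j = 0) ->
    forall j, (j < p)%N -> v j = 0) ->
  (t < p)%N -> (p <= n)%N -> exchanged t X ->
  exists2 s : 'I_n, (t <= s)%N & coords t X s != 0.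
Proof.
move=> free tp pn [M [MX Mt _]].
have [/existsP[s /andP[ts cs]]|no] :=
  boolP [exists s : 'I_n, (t <= s)%N && (coords t X s != 0)].
  by exists s.
have c0 (s : 'I_n) : (t <= s)%N -> coords t X s = 0.
  move=> ts; apply/eqP; apply: contraNT no => cs.
  by apply/existsP; exists s; rewrite ts.
(* The forbidden linear relation. [insub] only converts the index: for [j < t] its default is not
   reached, because [t < p <= n]. *)
pose v j := (if j == t then -1 else
  if (j < t)%N then (if insub j is Some j' then coords t X j' else 0) else 0).
suff : v t = 0 by rewrite /v eqxx => /eqP; rewrite oppr_eq0 oner_eq0.
apply: free => // i.
have XM : X *m M = 1%:M by apply: mulmx1C.
have tn : (t < n)%N by apply: leq_trans pn.
have bE : b i t = \sum_(l < n | (l < t)%N) coords t X l * b i l.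
  have -> : b i t = \sum_l coords t X l * M l i.
    under eq_bigr do rewrite mulr_suml.
    rewrite exchange_big /= (bigD1 i) //= [X in _ = _ + X]big1 ?addr0.
      under eq_bigr do rewrite -mulrA.
      rewrite -mulr_sumr.
      have /matrixP/(_ i i) := XM; rewrite !mxE eqxx => ->.
      by rewrite mulr1.
    move=> k ki; under eq_bigr do rewrite -mulrA.
    rewrite -mulr_sumr.
    by have /matrixP/(_ k i) := XM; rewrite !mxE (negPf ki) => ->; rewrite mulr0.
  rewrite (bigID (fun l : 'I_n => (l < t)%N)) /= [X in _ + X]big1 ?addr0.
    by apply: eq_bigr => l lt; rewrite Mt.
  by move=> l; rewrite -leqNgt => /c0 ->; rewrite mul0r.
rewrite (bigD1 (Ordinal tp)) //= {1}/v eqxx mulrN1 bE addrC; apply/eqP.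
rewrite subr_eq0; apply/eqP.
rewrite (bigID (fun l : 'I_p => (l < t)%N)) /= [X in _ + X]big1 ?addr0; last first.
  move=> l /andP[lt]; rewrite -leqNgt => tl; rewrite /v ifN //.
  by rewrite ltnNge tl mulr0.
rewrite (eq_bigl (fun l : 'I_p => (l < t)%N)); last first.
  move=> l; rewrite andb_idl // => lt; apply: contraTneq lt => ->.
  by rewrite /= ltnn.
rewrite (big_ord_narrow (ltnW tp)) (big_ord_narrow (ltnW tn)).
apply: eq_bigr => l _ /=; rewrite /v ifN ?ltn_ord; last first.
  by rewrite neq_ltn ltn_ord.
rewrite insubT ?(ltn_trans _ tn) // => ln.
by rewrite mulrC; congr (coords _ _ _ * _); apply: val_inj.
Qed.

End Exchange.

(** Padding the independent columns of [B] with zeros keeps them independent. *)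
Lemma mx_entry_free (d p : nat) (B : 'M[rat]_(d, p)) n : (d <= n)%N ->
  \rank B = p -> forall v : nat -> rat,
  (forall i : 'I_n, \sum_(j < p) mx_entry B i j * v j = 0) ->
  forall j, (j < p)%N -> v j = 0.
Proof.
move=> dn rB v Bv j jp.
have fB : row_free B^T by rewrite -row_leq_rank mxrank_tr rB.
have := mulmx_free_eq0 (\row_(j < p) v j) fB.
have -> : (\row_(j < p) v j) *m B^T = 0.
  apply/matrixP => k i; rewrite !mxE -[RHS](Bv (widen_ord dn i)).
  by apply: eq_bigr => l _; rewrite !mxE mulrC -mx_entryE.
rewrite eqxx => /esym/eqP/matrixP/(_ 0 (Ordinal jp)).
by rewrite !mxE.
Qed.

(** * Coordinates adapted to the lattice *)

Section Reformulation.
Variables (R : realType) (d e p m : nat) (I : miqp d e p m).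
Local Notation n := (d + e)%N.
Local Notation b := (mx_entry (qB I)).

Lemma usubmx_mulB (v : 'cV[int]_p) (i : 'I_d) :
  (map_mx ratr (qB I) *m map_mx intr v : 'cV[R]_d) i 0
  = \sum_(j < p) ratr (b i j) * (v j 0)%:~R.
Proof. by rewrite mxE; apply: eq_bigr => j _; rewrite !mxE mx_entryE. Qed.

Section Coordinates.
Variable X : 'M[rat]_n.

(** When [X] is exchanged up to [p], its columns from [p] on are orthogonal to the first [p] rows of
    [M], the zero-padded lattice vectors. They thus account for both the orthogonal complement of
    the lattice and the variables [z]. *)
Definition coord_mx : 'M[rat]_n :=
  \matrix_(i, j) if (j < p)%N then b i j else X i j.

Hypotheses (pn : (p <= n)%N) (exX : exchanged b p X).

Lemma coord_mxE (u : 'cV[R]_n) (i : 'I_n) :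
  (map_mx ratr coord_mx *m u) i 0 =
  \sum_(j < p) ratr (b i j) * u (widen_ord pn j) 0 +
  \sum_(j < n | (p <= j)%N) ratr (X i j) * u j 0.
Proof.
rewrite mxE (bigID (fun j : 'I_n => (j < p)%N)) /=; congr (_ + _).
  by rewrite (big_ord_narrow pn); apply: eq_bigr => j _; rewrite !mxE /= ltn_ord.
under eq_bigl do rewrite -leqNgt.
by apply: eq_bigr => j pj; rewrite !mxE ltnNge pj.
Qed.

(** Write [x] as a padded lattice vector plus [w]. The [y] part of [w] is orthogonal to the lattice
    exactly when the first [p] entries of [M w] vanish, and then [w = X (M w)] only involves the
    last columns of [X]. *)
Lemma lattice_cyl_coord (x : 'cV[R]_n) :
  lattice_cyl I (usubmx x) <->
  exists2 u : 'cV[R]_n,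
    (forall i : 'I_n, (i < p)%N -> u i 0 \is a Num.int) &
    x = map_mx ratr coord_mx *m u.
Proof.
have [M [MX Mb _]] := exX.
have XM : X *m M = 1%:M by apply: mulmx1C.
have MXR i l : \sum_j ratr (M i j) * ratr (X j l) = (i == l)%:R :> R.
  have /matrixP/(_ i l) := MX; rewrite !mxE => /(congr1 (ratr : rat -> R)).
  rewrite rmorph_nat => <-; rewrite raddf_sum; apply: eq_bigr => j _.
  by rewrite /= rmorphM.
have XMR i l : \sum_j ratr (X i j) * ratr (M j l) = (i == l)%:R :> R.
  have /matrixP/(_ i l) := XM; rewrite !mxE => /(congr1 (ratr : rat -> R)).
  rewrite rmorph_nat => <-; rewrite raddf_sum; apply: eq_bigr => j _.
  by rewrite /= rmorphM.
have b0 (i : 'I_n) j : (d <= i)%N -> b i j = 0 by apply: mx_entry_row0.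
split=> [[yL [v yLE] [y' y'perp xE]]|[u u_int ->]].
  (* What remains after removing the lattice part: its first [d] entries are [y'], the others are
     those of [z]. *)
  pose w (i : 'I_n) : R := x i 0 - \sum_(j < p) ratr (b i j) * (v j 0)%:~R.
  have wy' (i : 'I_d) : w (lshift e i) = y' i 0.
    have /matrixP/(_ i 0) := xE; rewrite [in RHS]mxE /w => <-.
    by rewrite mxE yLE usubmx_mulB /= addrAC subrr add0r.
  (* Testing [y'] against the lattice vector of index [t] gives entry [t] of [M w], since the zero
     padding removes the [z] part. *)
  have Mw0 (t : 'I_n) : (t < p)%N -> \sum_j ratr (M t j) * w j = 0.
    move=> tp; pose ev : 'cV[int]_p := \col_j (j == Ordinal tp)%:R.
    have : dotp y' (map_mx ratr (qB I) *m map_mx intr ev) = 0.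
      apply: y'perp; exists 1%N, (fun=> map_mx ratr (qB I) *m map_mx intr ev).
      exists (fun=> 1); split; first by move=> _; exists ev.
      by rewrite big_ord_recl big_ord0 scale1r addr0.
    move=> /esym Z; rewrite [RHS]Z big_split_ord /= [X in _ + X]big1 ?addr0.
      apply: eq_bigr => i _; rewrite Mb // wy' mulrC; congr (_ * _).
      rewrite usubmx_mulB (bigD1 (Ordinal tp)) //= big1 ?addr0.
        by rewrite mxE eqxx mulr1.
      by move=> j jt; rewrite mxE (negPf jt) mulr0.
    by move=> i _; rewrite Mb // b0 ?rmorph0 ?mul0r //= leq_addr.
  (* The coordinates of [w] on the columns of [X] are [M w]; the first [p] of them vanish, which
     leaves these places to the integers [v]. *)
  exists (\col_(j < n) if insub (val j) is Some j' then (v j' 0)%:~R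
      else \sum_l ratr (M j l) * w l).
    move=> i ip; rewrite mxE insubT; exact: intr_int.
  apply/matrixP => i k; rewrite ord1 {k} coord_mxE.
  transitivity (\sum_(j < p) ratr (b i j) * (v j 0)%:~R + w i).
    by rewrite /w addrCA subrr addr0.
  congr (_ + _).
    apply: eq_bigr => j _; rewrite mxE /= insubT // => jp.
    by congr (_ * (v _ _)%:~R); apply: val_inj.
  transitivity (\sum_j ratr (X i j) * \sum_l ratr (M j l) * w l).
    under eq_bigr do rewrite mulr_sumr.
    rewrite exchange_big /= (bigD1 i) //= [X in _ = _ + X]big1 ?addr0.
      under eq_bigr do rewrite mulrA.
      by rewrite -mulr_suml XMR eqxx mul1r.
    move=> l li; under eq_bigr do rewrite mulrA.
    by rewrite -mulr_suml XMR eq_sym (negPf li) mul0r.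
  rewrite (bigID (fun j : 'I_n => (p <= j)%N)) /= [X in _ + X]big1 ?addr0.
    by apply: eq_bigr => j pj; rewrite mxE insubN // -leqNgt.
  by move=> j; rewrite -ltnNge => jp; rewrite Mw0 // mulr0.
(* Conversely, the first [p] entries of [u] are integers, so taking floors loses nothing. *)
pose v : 'cV[int]_p := \col_j Num.floor (u (widen_ord pn j) 0).
have vE j : (v j 0)%:~R = u (widen_ord pn j) 0.
  by rewrite mxE floorK // u_int /=.
pose w (i : 'I_n) : R := \sum_(j < n | (p <= j)%N) ratr (X i j) * u j 0.
exists (map_mx ratr (qB I) *m map_mx intr v); first by exists v.
exists (\col_(i < d) w (lshift e i)); last first.
  apply/matrixP => i k; rewrite ord1 {k} [LHS]mxE usubmx_mulB mxE.
  rewrite mxE coord_mxE; congr (_ + _).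
  by apply: eq_bigr => j _; rewrite vE.
move=> y [h [s [t [sL ->]]]].
(* Orthogonality to the lattice comes from the zero entries of [M X = 1]; it then passes to the span
   by linearity. *)
have perp (v' : 'cV[int]_p) :
    dotp (\col_(i < d) w (lshift e i)) (map_mx ratr (qB I) *m map_mx intr v') = 0.
  rewrite /dotp; under eq_bigr do rewrite usubmx_mulB mulr_sumr.
  rewrite exchange_big /= big1 // => j _.
  under eq_bigr do rewrite mulrA.
  rewrite -mulr_suml.
  suff -> : \sum_(i < d) (\col_i w (lshift e i)) i 0 * ratr (b i j) =
     \sum_i ratr (M (widen_ord pn j) i) * w i.
    rewrite /w; under eq_bigr do rewrite mulr_sumr.
    rewrite exchange_big /= big1 ?mul0r // => l pl.
    under eq_bigr do rewrite mulrA.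
    rewrite -mulr_suml MXR; case: eqP => [jl|]; last by rewrite mul0r.
    by move: pl; rewrite -jl /= leqNgt ltn_ord.
  rewrite big_split_ord /= [X in _ = _ + X]big1 ?addr0.
    by apply: eq_bigr => i _; rewrite !mxE Mb ?(ltn_ord j) // mulrC.
  by move=> i _; rewrite Mb ?(ltn_ord j) // b0 ?rmorph0 ?mul0r //= leq_addr.
rewrite /dotp; under eq_bigr do rewrite summxE mulr_sumr.
rewrite exchange_big /= big1 // => j _.
have [v' sv] := sL j.
have := perp v'; rewrite -sv /dotp => pe.
under eq_bigr do rewrite [X in _ * X]mxE mulrCA.
by rewrite -mulr_sumr pe mulr0.
Qed.

End Coordinates.

End Reformulation.

(** * The objective and its linearization *)

Section Objective.
Variables (R : realType) (d e p m : nat) (I : miqp d e p m).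
Local Notation n := (d + e)%N.

(* [mx_entry] gives 0 beyond index [d], so that [z] has no quadratic part. *)
Definition quad (i : nat) : rat := mx_entry (qD I) i i.
Definition lin (i : nat) : rat :=
  if (i < d)%N then mx_entry (qc I) i 0 else mx_entry (ql I) (i - d) 0.

Hypothesis diagD : is_diag_mx (qD I).

Lemma quad_ge i : (d <= i)%N -> quad i = 0.
Proof. exact: mx_entry_row0. Qed.

Lemma objectiveE (x : 'cV[R]_n) : objective I x =
  \sum_(i < n) (ratr (quad i) * x i 0 ^+ 2 + ratr (lin i) * x i 0).
Proof.
rewrite big_split /= !big_split_ord /= [X in _ + X + _]big1 ?addr0; last first.
  by move=> i _; rewrite quad_ge ?leq_addr // rmorph0 mul0r.
rewrite addrA /objective; congr (_ + _ + _).
- rewrite -mulmxA mxE; apply: eq_bigr => i _.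
  rewrite [X in _ * X]mxE.
  rewrite (bigD1 i) //= big1 ?addr0.
    by rewrite !mxE /quad mx_entryE; ring.
  move=> j ji; have /is_diag_mxP D0 := diagD.
  by rewrite mxE D0 ?rmorph0 ?mul0r // eq_sym.
- rewrite mxE; apply: eq_bigr => i _.
  by rewrite !mxE /lin ltn_ord -[0%N]/(val (0 : 'I_1)) mx_entryE.
- rewrite mxE; apply: eq_bigr => i _; rewrite !mxE /lin ltnNge leq_addr /=.
  by rewrite addKn -[0%N]/(val (0 : 'I_1)) mx_entryE.
Qed.

(* The secant of [D_ii t^2] over [[lo i, up i]] has slope
   [D_ii (lo i + up i)]. *)
Definition secant (lo up : nat -> rat) (i : nat) : rat :=
  lin i + quad i * (lo i + up i).

(** In one coordinate with interval [[l, u]], [D t^2] equals its secant minus [D (t - l) (u - t)],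
    and the product lies between 0 and [(u - l)^2 / 4]. The corrections at [x] and [y] have the same
    sign, so their difference costs this bound only once. *)
Lemma objective_secant (lo up : nat -> rat) (k : nat) (x y : 'cV[R]_n) :
  (forall i : 'I_n, (k <= i)%N -> quad i = 0) ->
  (forall i : 'I_n, (i < k)%N ->
     ratr (lo i) <= x i 0 <= ratr (up i) /\
     ratr (lo i) <= y i 0 <= ratr (up i)) ->
  \sum_(i < n) ratr (secant lo up i) * x i 0 <=
    \sum_(i < n) ratr (secant lo up i) * y i 0 ->
  objective I x <= objective I y +
    \sum_(i < n | (i < k)%N) `|ratr (quad i)| * ratr (up i - lo i) ^+ 2 / 4.
Proof.
move=> q0 box gxy; rewrite !objectiveE -subr_ge0.
rewrite [X in _ + X - _](big_mkcond (fun i : 'I_n => (i < k)%N)) /=.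
rewrite -big_split /= -sumrB.
apply: le_trans (_ : 0 <= \sum_(i < n) ratr (secant lo up i) * y i 0 -
  \sum_(i < n) ratr (secant lo up i) * x i 0) _.
  by rewrite subr_ge0.
rewrite -sumrB; apply: ler_sum => i _; rewrite /secant.
rewrite !(rmorphD, rmorphM, rmorphN) /=.
set D : R := ratr (quad i); set c : R := ratr (lin i).
case: ltnP => ik; last first.
  by rewrite /D q0 // rmorph0; lra.
have [/andP[lx xu] /andP[ly yu]] := box _ ik.
move: lx xu ly yu; set l : R := ratr (lo i); set u : R := ratr (up i).
set s := x i 0; set t := y i 0 => lx xu ly yu.
have Hx : 0 <= (s - l) * (u - s) <= (u - l) ^+ 2 / 4.
  apply/andP; split; first by apply: mulr_ge0; rewrite subr_ge0.
  (* This square is [(u - l)^2 - 4 (s - l) (u - s)]. *)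
  have := sqr_ge0 (2 * s - l - u); nra.
have Hy : 0 <= (t - l) * (u - t) <= (u - l) ^+ 2 / 4.
  apply/andP; split; first by apply: mulr_ge0; rewrite subr_ge0.
  have := sqr_ge0 (2 * t - l - u); nra.
rewrite -subr_ge0.
have -> : D * t ^+ 2 + c * t + `|D| * (u - l) ^+ 2 / 4 - (D * s ^+ 2 + c * s)
  - ((c + D * (l + u)) * t - (c + D * (l + u)) * s)
  = `|D| * ((u - l) ^+ 2 / 4) + D * ((s - l) * (u - s) - (t - l) * (u - t)).
  by field.
move: Hx Hy; set P := (s - l) * _; set Q := (t - l) * _.
set W := _ / 4 => /andP[P0 PW] /andP[Q0 QW].
have [D0|D0] := ger0P D.
  by rewrite -mulrDr mulr_ge0 //; lra.
rewrite mulNr -mulrN -mulrDr; apply: mulr_le0; first exact: ltW.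
lra.
Qed.

End Objective.

(** * Variation of the objective over the feasible set *)

Section Spread.
Variables (R : realType) (d e p m : nat) (I : miqp d e p m).
Local Notation n := (d + e)%N.
Variable r : nat.
Hypothesis sfI : spherical_form R I r.

Lemma lattice2_cyl_sub (y : 'cV[R]_d) : lattice2_cyl I y -> lattice_cyl I y.
Proof.
move=> [u [u' [v u'E] uE] [w wp yE]]; exists u; last by exists w.
exists (v + v); rewrite map_mxD mulmxDr -u'E -uE.
by rewrite scaler_nat mulr2n.
Qed.

(** The reason for the factor 2 in the definition of aligned vectors: the midpoint of [2 u] and
    [2 u'] is the lattice point [u + u']. *)
Lemma lattice2_cyl_mid (y y' : 'cV[R]_d) : lattice2_cyl I y ->
  lattice2_cyl I y' -> lattice_cyl I (2^-1 *: (y + y')).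
Proof.
move=> [_ [u [v uE] <-] [w wp <-]] [_ [u' [v' uE'] <-] [w' wp' <-]].
exists (u + u'); first by exists (v + v'); rewrite map_mxD mulmxDr -uE -uE'.
exists (2^-1 *: (w + w')).
  move=> z Lz; have := wp _ Lz; have := wp' _ Lz; rewrite /dotp => e1 e2.
  under eq_bigr do rewrite !mxE -mulrA mulrDl.
  by rewrite -mulr_sumr big_split /= e1 e2 addr0 mulr0.
rewrite addrACA -scalerDr [RHS]scalerDr scalerA mulVf ?scale1r //.
by rewrite pnatr_eq0.
Qed.

Lemma polytope_mid (x y : 'cV[R]_n) : polytope_of I x -> polytope_of I y ->
  polytope_of I (2^-1 *: (x + y)).
Proof.
move=> Px Py i; have := Px i; have := Py i.
by rewrite -scalemxAr mulmxDr !mxE; lra.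
Qed.

(** The second difference of the objective at three feasible points is at most twice the variation
    in absolute value, and here it is at least [3 |D_11| / 8]. Sortedness of the diagonal extends
    the bound to every [i]. *)
Lemma aligned_spread (yp ym : 'cV[R]_d) (xmin xmax : 'cV[R]_n) :
  aligned I yp ym -> minimizer I xmin -> maximizer I xmax ->
  forall i, `|ratr (quad I i)| * 3 / 16 <= objective I xmax - objective I xmin.
Proof.
move=> [[ypB ypL] [ymB ymL] [i0 [i00 gap]] rest] [fmin mn] [fmax mx] i.
have [diagD sortD _ _ [ballP _]] := sfI.
have [zp Pp] := ballP _ ypB; have [zm Pm] := ballP _ ymB.
pose xp := col_mx yp zp; pose xm := col_mx ym zm.
pose xc := 2^-1 *: (xp + xm).
have Fp : feasible I xp.
  by split=> //; rewrite col_mxKu; apply: lattice2_cyl_sub.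
have Fm : feasible I xm.
  by split=> //; rewrite col_mxKu; apply: lattice2_cyl_sub.
have Fc : feasible I xc.
  split; first exact: polytope_mid.
  rewrite /xc add_col_mx scale_col_mx col_mxKu; exact: lattice2_cyl_mid.
have Sp := mn _ Fp; have Sm := mn _ Fm; have Sc := mn _ Fc.
have Tp := mx _ Fp; have Tm := mx _ Fm; have Tc := mx _ Fc.
have xcE j : xc j 0 = 2^-1 * (xp j 0 + xm j 0).
  by rewrite mxE [in LHS]mxE.
(* The linear terms cancel at the midpoint, and [z] has no quadratic term. *)
have curv : objective I xp + objective I xm - 2 * objective I xc =
    2^-1 * \sum_(j < d) ratr (quad I j) * (yp j 0 - ym j 0) ^+ 2.
  rewrite !objectiveE // -big_split /= !mulr_sumr -sumrB big_split_ord /=.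
  rewrite [X in _ + X]big1 ?addr0.
    by apply: eq_bigr => j _; rewrite xcE !col_mxEu; field.
  by move=> j _; rewrite xcE quad_ge ?leq_addr // rmorph0; field.
pose D1 : R := ratr (quad I i0).
have D1max j : `|ratr (quad I j)| <= `|D1|.
  have [jd|dj] := ltnP j d; last by rewrite quad_ge // rmorph0 normr0.
  rewrite -!ratr_norm ler_rat /quad !mx_entryE.
  rewrite -[j]/(val (Ordinal jd)) mx_entryE; apply: sortD.
  by rewrite i00.
have := D1max i.
pose S := \sum_(j < d | j != i0) ratr (quad I j) * (yp j 0 - ym j 0) ^+ 2.
have Sle : `|S| <= `|D1| / 4.
  apply: (le_trans (ler_norm_sum _ _ _)).
  apply: (@le_trans _ _ (\sum_(j < d | j != i0) `|D1| * (yp j 0 - ym j 0) ^+ 2)).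
    apply: ler_sum => j _; rewrite normrM (ger0_norm (sqr_ge0 _)).
    by apply: ler_wpM2r; rewrite ?sqr_ge0.
  rewrite -mulr_sumr; apply: ler_wpM2l => //.
  rewrite (eq_bigl (fun j : 'I_d => (0 < j)%N)) //.
  by move=> j; rewrite lt0n -i00 -val_eqE.
move: curv; rewrite (bigD1 i0) //= -/S -/D1.
have g1 : 1 <= (yp i0 0 - ym i0 0) ^+ 2.
  by rewrite -[1](expr1n _ 2) lerXn2r // ?nnegrE ?(le_trans _ gap).
have D1g : `|D1| <= `|D1 * (yp i0 0 - ym i0 0) ^+ 2|.
  by rewrite (normrM D1) [X in _ <= _ * X]ger0_norm ?sqr_ge0 // ler_peMr.
move: D1g Sle; set A := D1 * _ => D1g Sle curv Di.
(* The first coordinate contributes at least [|D1|]; the others together take away at most a quarter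
   of it. *)
have AS : `|D1| * 3 / 4 <= `|A + S|.
  have := lerB_dist A (- S); rewrite opprK normrN; lra.
move: AS; have [AS|AS] := ger0P (A + S); lra.
Qed.

End Spread.

(** * The MILP of a box *)

Section BoxMilp.
Variables (d e p m : nat) (I : miqp d e p m).
Local Notation n := (d + e)%N.
Variables (T : 'M[rat]_n) (k : nat) (lo up : nat -> rat).

Definition box_obj (j : nat) : rat :=
  \sum_(l < n) mx_entry T l j * secant I lo up l.

(** The system [W x <= w], [- x_i <= - lo_i], [x_i <= up_i] for [i < k], in this order, after the
    substitution [x = T u]. *)
Definition box_row (i j : nat) : rat :=
  if (i < m)%N then \sum_(l < n) mx_entry (qW I) i l * mx_entry T l j
  else if (i < m + k)%N then - mx_entry T (i - m) j
  else mx_entry T (i - (m + k)) j.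

Definition box_rhs (i : nat) : rat :=
  if (i < m)%N then mx_entry (qw I) i 0
  else if (i < m + k)%N then - lo (i - m) else up (i - (m + k)).

(* The variables are the coordinates [u] of the point [T u]. *)
Definition box_milp : milp :=
  @Milp n p (m + (k + k)) (\col_j box_obj j) (\matrix_(i, j) box_row i j)
    (\col_i box_rhs i).

Variable R : realType.
Local Notation TR := (map_mx ratr T : 'M[R]_n).
Implicit Types u : 'cV[R]_n.

Lemma box_milp_value u : milp_value (Q := box_milp) u =
  \sum_(l < n) ratr (secant I lo up l) * (TR *m u) l 0.
Proof.
rewrite /milp_value mxE /=.
under eq_bigr do rewrite !mxE raddf_sum mulr_suml.
rewrite exchange_big /=; apply: eq_bigr => l _.
rewrite mxE mulr_sumr; apply: eq_bigr => j _.
by rewrite mx_entryE !mxE rmorphM; ring.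
Qed.

Lemma box_row_polytope u (i : 'I_m) :
  \sum_(j < n) ratr (box_row i j) * u j 0
  = (map_mx ratr (qW I) *m (TR *m u)) i 0.
Proof.
rewrite [RHS]mxE.
under eq_bigr do rewrite /box_row ltn_ord raddf_sum mulr_suml.
rewrite exchange_big /=; apply: eq_bigr => l _.
rewrite !mxE mulr_sumr; apply: eq_bigr => j _.
by rewrite !mx_entryE !mxE rmorphM; ring.
Qed.

Lemma mx_entry_dot u (i : 'I_n) :
  \sum_(j < n) ratr (mx_entry T i j) * u j 0 = (TR *m u) i 0.
Proof. by rewrite mxE; apply: eq_bigr => j _; rewrite mx_entryE mxE. Qed.

Hypothesis kn : (k <= n)%N.

Lemma box_milp_feasible u : milp_feasible (Q := box_milp) u <->
  [/\ polytope_of I (TR *m u),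
      forall i : 'I_n, (i < k)%N ->
        ratr (lo i) <= (TR *m u) i 0 <= ratr (up i)
    & forall i : 'I_n, (i < p)%N -> u i 0 \is a Num.int].
Proof.
have rowE (i : 'I_(m + (k + k))) : ((map_mx ratr (mW box_milp) *m u) i 0
    <= ratr (mw box_milp i 0)) =
    (\sum_(j < n) ratr (box_row i j) * u j 0 <= ratr (box_rhs i)).
  by rewrite !mxE /=; under eq_bigr do rewrite !mxE.
split=> [[Wu u_int]|[Pu bu u_int]]; split=> //.
- move=> i; have := Wu (lshift (k + k) i); rewrite rowE box_row_polytope.
  by rewrite /box_rhs /= ltn_ord -[0%N]/(val (0 : 'I_1)) mx_entryE.
- move=> i ik.
  have := Wu (rshift m (lshift k (Ordinal ik))).
  have := Wu (rshift m (rshift k (Ordinal ik))).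
  rewrite !rowE /box_rhs /box_row /= ltnNge leq_addr /= ltn_add2l.
  rewrite ltnNge leq_addr /= addnA addKn mx_entry_dot.
  rewrite ltnNge leq_addr /= ltn_add2l ik addKn.
  under eq_bigr do rewrite rmorphN mulNr.
  by rewrite sumrN mx_entry_dot rmorphN lerN2 => -> ->.
- move=> i; rewrite [_ <= _]rowE.
  have [im|mi] := ltnP i m.
    rewrite -[val i]/(val (Ordinal im)) box_row_polytope.
    have := Pu (Ordinal im); rewrite /box_rhs /= im.
    by rewrite -[0%N]/(val (0 : 'I_1)) -[val i]/(val (Ordinal im)) mx_entryE.
  rewrite /box_row /box_rhs ltnNge mi /=.
  have [ik|ki] := ltnP i (m + k).
    have jk : (i - m < k)%N by rewrite ltn_subLR.
    have jn : (i - m < n)%N by apply: leq_trans kn.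
    under eq_bigr do rewrite rmorphN mulNr.
    rewrite sumrN rmorphN lerN2 (mx_entry_dot u (Ordinal jn)).
    by have /andP[] := bu (Ordinal jn) jk.
  have jk : (i - (m + k) < k)%N by rewrite ltn_subLR // -addnA ltn_ord.
  have jn : (i - (m + k) < n)%N by apply: leq_trans kn.
  rewrite (mx_entry_dot u (Ordinal jn)).
  by have /andP[] := bu (Ordinal jn) jk.
Qed.

End BoxMilp.

(** * From the answer of the solver to the points of a box *)

Section BoxAnswer.
Variables (R : realType) (d e p m : nat) (I : miqp d e p m) (r : nat).
Local Notation n := (d + e)%N.
Variables (X : 'M[rat]_n) (k : nat) (lo up : nat -> rat) (O : milp_solver).
Hypotheses (pn : (p <= n)%N) (exX : exchanged (mx_entry (qB I)) p X).
Hypotheses (kn : (k <= n)%N).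
Hypothesis quad0 : forall i : 'I_n, (k <= i)%N -> quad I i = 0.
Hypothesis sfI : spherical_form R I r.
Hypothesis O_ok : solver_ok R O.
Local Notation T := (coord_mx I X).
Local Notation Q := (box_milp I T k lo up).

Definition in_box (x : 'cV[R]_n) : Prop :=
  forall i : 'I_n, (i < k)%N -> ratr (lo i) <= x i 0 <= ratr (up i).

(** By [lattice_cyl_coord], [T] maps the MILP-feasible points onto the feasible points in the box,
    so an optimal answer is optimal for the secant objective there, and [objective_secant] bounds
    the loss. Boundedness of the polytope excludes an unbounded MILP. *)
Lemma box_milp_answer :
  match O Q with
  | Optimal x => let x : 'cV[R]_n := map_mx ratr (T *m x) in
      feasible I x /\ forall y, feasible I y -> in_box y ->
      objective I x <= objective I y + \sum_(i < n | (i < k)%N)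
         `|ratr (quad I i)| * ratr (up i - lo i) ^+ 2 / 4
  | Infeasible => forall y, feasible I y -> ~ in_box y
  | Unbounded => False
  end.
Proof.
have [diagD _ _ [Mb bnd] _] := sfI.
have lift (y : 'cV[R]_n) : feasible I y -> in_box y ->
    exists2 u : 'cV[R]_n, milp_feasible (Q := Q) u & map_mx ratr T *m u = y.
  move=> [Py /(lattice_cyl_coord pn exX)[u u_int yE]] yb.
  by exists u => //; apply/box_milp_feasible => //; split; rewrite -?yE.
have := O_ok Q; case: (O Q) => [x||] /=.
- move=> [Fx opt]; rewrite map_mxM.
  have [Px bx x_int] := (box_milp_feasible I T lo up kn _).1 Fx.
  split.
    split=> //; apply/(lattice_cyl_coord pn exX).
    by exists (map_mx ratr x).
  move=> y Fy yb; have [u Fu uE] := lift y Fy yb.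
  have := opt _ Fu; rewrite !box_milp_value uE.
  apply: objective_secant => // i ik; split; first exact: bx.
  exact: yb.
- by move=> inf y Fy yb; have [u Fu _] := lift y Fy yb; apply: inf Fu.
(* A lower bound for the secant objective on the whole polytope, whose coordinates are at most [Mb]
   in absolute value. *)
- move=> /(_ (- \sum_(l < n) `|ratr (secant I lo up l)| * Mb))[u].
  move=> /(box_milp_feasible I T lo up kn)[Pu _ _].
  rewrite box_milp_value ltNge => /negP; apply.
  rewrite -sumrN; apply: ler_sum => l _; apply: lerNnormlW.
  by rewrite normrM ler_wpM2l // bnd.
Qed.

End BoxAnswer.

(** * The program *)

Section RunFrame.
Variables (R : realType) (eps : R) (O : milp_solver).
Local Notation run := (run eps O).

Lemma run_frameN b i c s : b \notin nwrites c ->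
  nmem (run c s) b i = nmem s b i.
Proof. by move=> bc; rewrite (proj1 (run_same_off eps O c s)). Qed.

Lemma run_frameQ b i j c s : b \notin qwrites c ->
  qmem (run c s) b i j = qmem s b i j.
Proof. by move=> bc; rewrite (proj2 (run_same_off eps O c s)). Qed.

Lemma run_Solve s en ep em ao aW aw ax n p m (f : 'cV_n) (W : 'M_(m, n))
    (w : 'cV_m) :
  neval s en = n -> neval s ep = p -> neval s em = m ->
  (forall j : 'I_n, qmem s ao j 0 = f j 0) ->
  (forall (i : 'I_m) (j : 'I_n), qmem s aW i j = W i j) ->
  (forall i : 'I_m, qmem s aw i 0 = w i 0) ->
  let s' := run (Solve en ep em ao aW aw ax) s in
  calls s' = rcons (calls s) (@Milp n p m f W w) /\
  match O (@Milp n p m f W w) with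
  | Optimal x => nmem s' ax 0 = 1%N /\ forall i : 'I_n, qmem s' ax i 0 = x i 0
  | _ => nmem s' ax 0 != 1%N
  end.
Proof.
move=> nE pE mE fE WE wE /=; rewrite nE pE mE /solve_step.
have -> : \col_i qmem s ao i 0 = f by apply/colP => j; rewrite mxE fE.
have -> : \matrix_(i, j) qmem s aW i j = W.
  by apply/matrixP => i j; rewrite mxE WE.
have -> : \col_i qmem s aw i 0 = w by apply/colP => j; rewrite mxE wE.
case: (O _) => [x||]; split=> //=; rewrite ?eqxx //.
by split=> // i; rewrite -[0%N]/(val (0 : 'I_1)) mx_entryE.
Qed.

End RunFrame.

(* Memory layout: [v_] are arrays of naturals, [a_] arrays of rationals; the
   arrays of rationals 0 to 6 and the array of naturals 0 hold the input. *)
Local Notation vi := 1%N (only parsing).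
Local Notation vj := 2%N (only parsing).
Local Notation vl := 3%N (only parsing).
Local Notation vt := 4%N (only parsing).
Local Notation vk := 5%N (only parsing).
Local Notation vphi := 6%N (only parsing).
Local Notation vpow := 7%N (only parsing).
Local Notation vn := 8%N (only parsing).
Local Notation vs := 9%N (only parsing).
Local Notation vbest := 10%N (only parsing).
Local Notation vcol := 11%N (only parsing).
Local Notation aX := 7%N (only parsing).
Local Notation aB := 8%N (only parsing).
Local Notation aY := 9%N (only parsing).
Local Notation aS := 10%N (only parsing).
Local Notation aT := 11%N (only parsing).
Local Notation aW := 12%N (only parsing).
Local Notation aw := 13%N (only parsing).
Local Notation ao := 14%N (only parsing).
Local Notation ax := 15%N (only parsing).
Local Notation apt := 16%N (only parsing).
Local Notation abest := 17%N (only parsing).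
Local Notation aval := 18%N (only parsing).
Local Notation abval := 19%N (only parsing).
Local Notation alin := 20%N (only parsing).
Local Notation atmp := 21%N (only parsing).

Definition rd (a : nat) : nexp := NGet a (NConst 0).
Definition inp (i : nat) : nexp := NGet 0 (NConst i).
Definition BLtN (s t : nexp) : bexp := BLeN (NAdd s (NConst 1)) t.
Definition BEqN (s t : nexp) : bexp := BAnd (BLeN s t) (BLeN t s).
Definition BNz (t : qexp) : bexp :=
  BNot (BAnd (BLeQ t (QConst 0)) (BLeQ (QConst 0) t)).
Definition q1 (a : nat) (i : nexp) : qexp := QGet a i (NConst 0).
Definition setv (a : nat) (t : nexp) : cmd := SetN a (NConst 0) t.
Definition setq (a : nat) (t : qexp) : cmd := SetQ a (NConst 0) (NConst 0) t.

(** * Preprocessing: rank, grid size, powers, exchange steps *)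

Section Phases.
Variables (R : realType) (eps : R) (O : milp_solver).
Local Notation run := (run eps O).

Lemma beval_BEqN s t1 t2 :
  beval eps s (BEqN t1 t2) = (neval s t1 == neval s t2).
Proof. by rewrite /= -eqn_leq. Qed.

Lemma beval_BLtN s t1 t2 :
  beval eps s (BLtN t1 t2) = (neval s t1 < neval s t2)%N.
Proof. by rewrite /= addn1. Qed.

Lemma beval_BNz s t : beval eps s (BNz t) = (qeval s t != 0).
Proof. by rewrite /= -eq_le. Qed.

Definition c_rank : cmd :=
  Seq (setv vk (NConst 0))
      (For vi (inp 0) (If (BNz (QGet 0 (rd vi) (rd vi)))
                          (setv vk (NAdd (rd vk) (NConst 1))) Skip)).

Lemma run_rank s : nmem (run c_rank s) vk 0 =
  (\sum_(i < nmem s 0 0) (qmem s 0 i i != 0%R))%N.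
Proof.
rewrite /c_rank run_Seq; set s1 := run _ s.
apply: (run_For (P := fun i s' =>
  nmem s' vk 0 = (\sum_(j < i) (qmem s 0 j j != 0%R))%N)) => //.
  by rewrite big_ord0.
move=> i s' _ [_ sq] vE IH; rewrite run_If beval_BNz /= vE sq //.
by rewrite big_ord_recr /=; case: eqP => _ //=; rewrite IH ?addn0 ?addn1.
Qed.

(* [M] is at least [1] and [1 / eps], so that the search range contains the
   least [phi] with [16 r^2 k <= 3 eps phi^2]. *)
Definition c_phi (M : nat) : cmd :=
  Seq (setv vphi (NConst 0))
      (For vi (NMul (NConst (4 * M)) (NMul (inp 4) (rd vk)))
         (If (BEps (QNat (NMul (NConst 16) (NMul (NMul (inp 4) (inp 4)) (rd vk))))
                   (QNat (NMul (NConst 3) (NMul (rd vphi) (rd vphi)))))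
             Skip (setv vphi (NAdd (rd vphi) (NConst 1))))).

(** The inequality [4 r sqrt (k / (3 eps)) <= phi], squared and cleared of denominators to avoid the
    square root. *)
Definition fine_enough (r k phi : nat) : bool :=
  (16 * (r * r * k))%:R <= eps * (3 * (phi * phi))%:R.

(** The number of rounds is fixed, so the search idles after success: [phi] keeps pace with the
    counter up to the first success and is then frozen. Without success it ends at the bound of the
    range, which is fine by hypothesis. *)
Lemma run_phi M s : let r := nmem s 0 4 in let k := nmem s vk 0 in
  fine_enough r k (4 * M * (r * k)) ->
  let phi := nmem (run (c_phi M) s) vphi 0 in
  fine_enough r k phi /\ forall j, (j < phi)%N -> ~~ fine_enough r k j.
Proof.
move=> r k fN; rewrite /c_phi run_Seq; set s1 := run _ s.
pose P i s' := [/\ (nmem s' vphi 0 <= i)%N,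
  (nmem s' vphi 0 < i)%N -> fine_enough r k (nmem s' vphi 0) &
  forall j, (j < nmem s' vphi 0)%N -> ~~ fine_enough r k j].
suff [] : P (4 * M * (r * k))%N (run (For vi (NMul (NConst (4 * M))
    (NMul (inp 4) (rd vk))) (If (BEps (QNat (NMul (NConst 16)
        (NMul (NMul (inp 4) (inp 4)) (rd vk))))
                   (QNat (NMul (NConst 3) (NMul (rd vphi) (rd vphi)))))
             Skip (setv vphi (NAdd (rd vphi) (NConst 1))))) s1).
  rewrite leq_eqVlt => /orP[/eqP -> _ |lt /(_ lt) ok] mini; split=> //.
apply: (run_For (P := P)) => //.
move=> i s' _ [sn _] vE [le ok mini]; rewrite run_If.
have -> : beval eps s' (BEps (QNat (NMul (NConst 16)
        (NMul (NMul (inp 4) (inp 4)) (rd vk))))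
                   (QNat (NMul (NConst 3) (NMul (rd vphi) (rd vphi)))))
   = fine_enough r k (nmem s' vphi 0).
  by rewrite /= (sn 0%N) // (sn vk) //= !ratr_nat.
case: ifP => t; first by split=> //; exact: leqW.
have E : nmem s' vphi 0 = i.
  by move: le; rewrite leq_eqVlt => /orP[/eqP//|/ok]; rewrite t.
rewrite /P /= addn1 E; split=> //; first by rewrite ltnn.
move=> j; rewrite ltnS leq_eqVlt => /orP[/eqP->|ji]; first by rewrite -E t.
by apply: mini; rewrite E.
Qed.

(** The language has no exponentiation, and extracting base [phi] digits needs all powers. *)
Definition c_pow : cmd :=
  Seq (SetN vpow (NConst 0) (NConst 1))
      (For vi (rd vn) (SetN vpow (NAdd (rd vi) (NConst 1))
                         (NMul (NGet vpow (rd vi)) (rd vphi)))).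

Lemma run_pow s j : (j <= nmem s vn 0)%N ->
  nmem (run c_pow s) vpow j = (nmem s vphi 0 ^ j)%N.
Proof.
rewrite /c_pow run_Seq; set s1 := run _ s; move: j.
apply: (run_For (P := fun i s' => forall j, (j <= i)%N ->
  nmem s' vpow j = (nmem s vphi 0 ^ j)%N)) => //.
  by move=> j; rewrite leqn0 => /eqP ->.
move=> i s' _ [sn _] vE IH j; rewrite /= vE addn1 leq_eqVlt.
have [->|] /= := eqVneq j i.+1; first by rewrite IH // sn //= expnSr.
by move=> _; rewrite ltnS; apply: IH.
Qed.

(** Kronecker delta: with truncated subtraction the inner sum is the distance of [i] and [j]. *)
Definition delta (i j : nexp) : qexp :=
  QNat (NSub (NConst 1) (NAdd (NSub i j) (NSub j i))).

Lemma qeval_delta s t1 t2 :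
  qeval s (delta t1 t2) = (neval s t1 == neval s t2)%:R.
Proof. by rewrite /=; case: eqP => h; congr (_%:R); lia. Qed.

Definition c_id : cmd :=
  Fill aX vi (rd vn) vj (rd vn) Skip (delta (rd vi) (rd vj)).

Lemma run_id s (i j : 'I_(nmem s vn 0)) :
  qmem (run c_id s) aX i j = (1%:M : 'M[rat]_(nmem s vn 0)) i j.
Proof.
rewrite (@run_Fill _ _ _ _ _ _ _ _ _ _ _ (nmem s vn 0) (nmem s vn 0)
  (fun i j => (i == j)%:R)) //.
- by rewrite !ltn_ord mxE.
- by move=> s' [sn _] /=; rewrite sn.
- by move=> s' [sn _] /=; rewrite sn.
- by move=> s' i' j' _ _ _ vE1 vE2; rewrite qeval_delta /= vE1 vE2.
Qed.

Definition c_coords : cmd :=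
  Fill aB vi (rd vn) vj (NConst 1)
    (SumQ aS vl (rd vn) (QMul (QGet 3 (rd vl) (rd vt)) (QGet aX (rd vl) (rd vi))))
    (q1 aS (NConst 0)).

Lemma run_coords s n b (X : 'M[rat]_n) t : nmem s vn 0 = n ->
  nmem s vt 0 = t -> (forall i j, qmem s 3 i j = b i j) ->
  (forall i j : 'I_n, qmem s aX i j = X i j) ->
  forall i : 'I_n, qmem (run c_coords s) aB i 0 = coords b t X i.
Proof.
move=> nE tE bE XE i.
rewrite (@run_Fill _ _ _ _ _ _ _ _ _ _ _ n 1
  (fun i _ => \sum_(l < n) b l t * mx_entry X l i)) //.
- by rewrite ltn_ord; apply: eq_bigr => l _; rewrite mx_entryE.
- by move=> s' [sn _] /=; rewrite sn.
- move=> s' i' j' [sn sq] i'n _ vE1 vE2.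
  apply: (@run_SumQ _ _ _ _ _ _ _ _ _ (fun l => b l t * mx_entry X l i')).
  + by move=> s2 [sn2 _] /=; rewrite sn2 // sn.
  + move=> s2 l [sn2 sq2] lE ln /=.
    rewrite lE !sq2 // !sn2 // !sq // vE1 sn // tE bE.
    by rewrite (XE (Ordinal ln) (Ordinal i'n)) -mx_entryE.
Qed.

(** A loop cannot be left early, so each hit overwrites the previous one; any pivot with index at
    least [t] will do. *)
Definition c_search : cmd :=
  For vi (rd vn)
    (If (BAnd (BLeN (rd vt) (rd vi)) (BNz (q1 aB (rd vi))))
        (setv vs (rd vi)) Skip).

Lemma run_search s n (f : 'I_n -> rat) : nmem s vn 0 = n ->
  (forall i : 'I_n, qmem s aB i 0 = f i) ->
  (exists2 i : 'I_n, (nmem s vt 0 <= i)%N & f i != 0) ->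
  exists i : 'I_n, [/\ nmem (run c_search s) vs 0 = i, (nmem s vt 0 <= i)%N
    & f i != 0].
Proof.
move=> nE fE [i0 ti0 fi0].
pose P i s' := forall i1 : 'I_n, (i1 < i)%N -> (nmem s vt 0 <= i1)%N -> f i1 != 0 ->
  exists i : 'I_n, [/\ nmem s' vs 0 = i, (nmem s vt 0 <= i)%N & f i != 0].
suff : P n (run c_search s) by move=> /(_ i0 (ltn_ord i0)); apply.
apply: (run_For (P := P)) => //.
move=> i s' iN [sn sq] vE IH i1 i1i ti1 fi1.
rewrite run_If /= -eq_le vE sn // sq //.
move: i1i; rewrite ltnS leq_eqVlt => /orP[/eqP i1E|i1i].
  by rewrite -i1E ti1 fE fi1 /=; exists i1.
have IH1 := IH i1 i1i ti1 fi1.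
case: leqP => //= ti; rewrite (fE (Ordinal iN)); case: eqP => //= /eqP fi.
by exists (Ordinal iN).
Qed.

(** The result goes to [aY] because the update reads old entries of [X] throughout. The choice of
    [vcol] performs the swap of columns on the fly. *)
Definition c_pivot : cmd :=
  Fill aY vi (rd vn) vj (rd vn)
    (If (BEqN (rd vj) (rd vt))
       (setq atmp (QMul (QGet aX (rd vi) (rd vs)) (QInv (q1 aB (rd vs)))))
       (Seq (If (BEqN (rd vj) (rd vs)) (setv vcol (rd vt)) (setv vcol (rd vj)))
            (setq atmp (QAdd (QGet aX (rd vi) (rd vcol))
               (QOpp (QMul (q1 aB (rd vcol))
                  (QMul (QGet aX (rd vi) (rd vs)) (QInv (q1 aB (rd vs))))))))))
    (q1 atmp (NConst 0)).

Lemma run_pivot s n (X : 'M[rat]_n) (f : 'I_n -> rat) (t pv : 'I_n) :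
  nmem s vn 0 = n -> nmem s vt 0 = t -> nmem s vs 0 = pv ->
  (forall i : 'I_n, qmem s aB i 0 = f i) ->
  (forall i j : 'I_n, qmem s aX i j = X i j) ->
  forall i l : 'I_n, qmem (run c_pivot s) aY i l =
    if l == t then X i pv / f pv else
     let l' := if l == pv then t else l in
     X i l' - f l' * (X i pv / f pv).
Proof.
move=> nE tE pvE fE XE i l.
pose E (i l : nat) := if (l == t)%N then qmem s aX i pv / qmem s aB pv 0 else
     let l' := if (l == pv)%N then val t else l in
     qmem s aX i l' - qmem s aB l' 0 * (qmem s aX i pv / qmem s aB pv 0).
rewrite (@run_Fill _ _ _ _ _ _ _ _ _ _ _ n n E) //.
- rewrite !ltn_ord /E /= !XE !fE !val_eqE; case: ifP => // _.
  by case: ifP; rewrite XE fE.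
- by move=> s' [sn _] /=; rewrite sn.
- by move=> s' [sn _] /=; rewrite sn.
- move=> s' i' j' [sn sq] _ _ vE1 vE2; rewrite run_If beval_BEqN /= vE2 sn // tE.
  rewrite /E; case: ifP => jt /=; rewrite -?eqn_leq.
    by rewrite vE1 !sq // !sn // pvE.
  rewrite !sn // pvE; case: ifP => js /=.
    by rewrite vE1 !sq // !sn // pvE.
  by rewrite vE1 !sq // !sn // pvE.
Qed.

Definition c_copy : cmd :=
  Fill aX vi (rd vn) vj (rd vn) Skip (QGet aY (rd vi) (rd vj)).

Lemma run_copy s (i j : 'I_(nmem s vn 0)) :
  qmem (run c_copy s) aX i j = qmem s aY i j.
Proof.
rewrite (@run_Fill _ _ _ _ _ _ _ _ _ _ _ (nmem s vn 0) (nmem s vn 0)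
  (fun i j => qmem s aY i j)) //.
- by rewrite !ltn_ord.
- by move=> s' [sn _] /=; rewrite sn.
- by move=> s' [sn _] /=; rewrite sn.
- by move=> s' i' j' [_ sq] _ _ vE1 vE2 /=; rewrite vE1 vE2 sq.
Qed.

Definition c_exch : cmd :=
  For vt (inp 2) (Seq c_coords (Seq c_search (Seq c_pivot c_copy))).

(** After [t] rounds [aX] holds the inverse of a matrix with the first [t] columns of [b] as rows,
    and independence provides a pivot for the next round. *)
Lemma run_exch s n p (b : nat -> nat -> rat) : nmem s vn 0 = n ->
  nmem s 0 2 = p -> (p <= n)%N -> (forall i j, qmem s 3 i j = b i j) ->
  (forall v : nat -> rat, (forall i : 'I_n, \sum_(j < p) b i j * v j = 0) ->
    forall j, (j < p)%N -> v j = 0) ->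
  (forall i j : 'I_n, qmem s aX i j = (1%:M : 'M[rat]_n) i j) ->
  exists X : 'M[rat]_n, exchanged b p X /\
    forall i j : 'I_n, qmem (run c_exch s) aX i j = X i j.
Proof.
move=> nE pE pn bE free X0.
apply: (run_For (P := fun t s' => exists X : 'M[rat]_n, exchanged b t X /\
    forall i j : 'I_n, qmem s' aX i j = X i j)) => //.
  by exists 1%:M; split=> //; apply: exchanged0.
move=> t s' tp [sn sq] tE [X [exX XE]].
have tn : (t < n)%N by apply: leq_trans pn.
rewrite !run_Seq; set s1 := run c_coords s'; set s2 := run c_search s1.
set s3 := run c_pivot s2.
have cE : forall i : 'I_n, qmem s1 aB i 0 = coords b t X i.
  by apply: run_coords => // [|i j]; rewrite ?sn // ?sq.
have [pv []] : exists i : 'I_n, [/\ nmem s2 vs 0 = i, (nmem s1 vt 0 <= i)%N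
    & coords b t X i != 0].
  apply: run_search cE _; first by rewrite run_frameN // sn.
  by rewrite run_frameN // tE; apply: (coords_neq0 free tp pn exX).
rewrite (@run_frameN _ _ _ vt) // tE => pvE tpv cpv.
have Y := @run_pivot s2 n X (coords b t X) (Ordinal tn) pv.
exists (\matrix_(i, l) (if l == Ordinal tn then X i pv / coords b t X pv else
     let l' := if l == pv then Ordinal tn else l in
     X i l' - coords b t X l' * (X i pv / coords b t X pv))); split.
  by apply: (exchanged_step (t := Ordinal tn)).
have s3n : nmem s3 vn 0 = n by rewrite !run_frameN // sn.
move=> i j; have := @run_copy s3; rewrite s3n => ->.
rewrite Y ?mxE //; first by rewrite !run_frameN // sn.
- by rewrite !run_frameN.
- by move=> l; rewrite run_frameQ.
- by move=> l l'; rewrite !run_frameQ.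
Qed.

End Phases.

(** * Construction and enumeration of the boxes *)

Section Assembly.
Variables (R : realType) (eps : R) (O : milp_solver).
Local Notation run := (run eps O).
Variables (d e p m : nat) (I : miqp d e p m) (r : nat).
Local Notation n := (d + e)%N.
Local Notation s0 := (init_state I r).

Definition inputs_ok (s : state) : Prop :=
  (forall i, nmem s 0 i = nmem s0 0 i) /\ nmem s vn 0 = n /\
  (forall a i j, (a < 7)%N -> qmem s a i j = qmem s0 a i j).

Lemma inputs_ok_off wn wq s s' : same_off wn wq s s' ->
  ~~ has (fun x => (x == 0) || (x == vn))%N wn ->
  ~~ has (fun x => x < 7)%N wq ->
  inputs_ok s -> inputs_ok s'.
Proof.
move=> [sn sq] /hasPn nn /hasPn nq [N0 [Nn Q0]].
have h0 : 0%N \notin wn by apply/negP => /nn.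
have hn : vn \notin wn by apply/negP => /nn.
split; last split.
- by move=> i; rewrite sn.
- by rewrite sn.
- by move=> a i j a7; rewrite sq ?Q0 //; apply/negP => /nq; rewrite a7.
Qed.

Definition c_coord_mx : cmd :=
  Fill aT vi (rd vn) vj (rd vn)
    (If (BLtN (rd vj) (inp 2)) (setq atmp (QGet 3 (rd vi) (rd vj)))
                               (setq atmp (QGet aX (rd vi) (rd vj))))
    (q1 atmp (NConst 0)).

Lemma run_coord_mx s (X : 'M[rat]_n) : inputs_ok s ->
  (forall i j : 'I_n, qmem s aX i j = X i j) ->
  forall i j : 'I_n, qmem (run c_coord_mx s) aT i j = coord_mx I X i j.
Proof.
move=> [N0 [Nn Q0]] XE i j.
rewrite (@run_Fill _ _ _ _ _ _ _ _ _ _ _ n n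
  (fun i j => if (j < p)%N then mx_entry (qB I) i j else mx_entry X i j)) //.
- by rewrite !ltn_ord mxE mx_entryE.
- by move=> s' [sn _] /=; rewrite sn.
- by move=> s' [sn _] /=; rewrite sn.
- move=> s' i' j' [sn sq] i'n j'n vE1 vE2.
  rewrite run_If beval_BLtN /= vE2 sn // N0 /=.
  case: ifP => _ /=; rewrite vE1 sq //; first by rewrite Q0.
  by rewrite (XE (Ordinal i'n) (Ordinal j'n)) -mx_entryE.
Qed.

Definition c_lin : cmd :=
  Fill alin vi (rd vn) vj (NConst 1)
    (If (BLtN (rd vi) (inp 0)) (setq atmp (q1 1 (rd vi)))
                               (setq atmp (q1 2 (NSub (rd vi) (inp 0)))))
    (q1 atmp (NConst 0)).

Lemma run_lin s : inputs_ok s ->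
  forall i : 'I_n, qmem (run c_lin s) alin i 0 = lin I i.
Proof.
move=> [N0 [Nn Q0]] i.
rewrite (@run_Fill _ _ _ _ _ _ _ _ _ _ _ n 1 (fun i _ => lin I i)) //.
- by rewrite ltn_ord.
- by move=> s' [sn _] /=; rewrite sn.
- move=> s' i' j' [sn sq] i'n j'n vE1 vE2.
  rewrite run_If beval_BLtN /= vE1 sn // N0 /= /lin.
  by case: ifP => _ /=; rewrite ?sn // ?N0 sq // Q0.
Qed.

Definition rows : nexp := NAdd (inp 3) (NAdd (rd vk) (rd vk)).

Definition c_row : cmd :=
  Fill aW vi rows vj (rd vn)
    (If (BLtN (rd vi) (inp 3))
       (SumQ atmp vl (rd vn)
          (QMul (QGet 4 (rd vi) (rd vl)) (QGet aT (rd vl) (rd vj))))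
       (If (BLtN (rd vi) (NAdd (inp 3) (rd vk)))
          (setq atmp (QOpp (QGet aT (NSub (rd vi) (inp 3)) (rd vj))))
          (setq atmp (QGet aT (NSub (rd vi) (NAdd (inp 3) (rd vk))) (rd vj)))))
    (q1 atmp (NConst 0)).

Lemma run_row s (T : 'M[rat]_n) k : inputs_ok s -> nmem s vk 0 = k ->
  (k <= n)%N -> (forall i j : 'I_n, qmem s aT i j = T i j) ->
  forall (i : 'I_(m + (k + k))) (j : 'I_n),
    qmem (run c_row s) aW i j = box_row I T k i j.
Proof.
move=> [N0 [Nn Q0]] kE kn TE i j.
have TE' i' j' : (i' < n)%N -> (j' < n)%N -> qmem s aT i' j' = mx_entry T i' j'.
  by move=> hi hj; rewrite (TE (Ordinal hi) (Ordinal hj)) -mx_entryE.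
rewrite (@run_Fill _ _ _ _ _ _ _ _ _ _ _ (m + (k + k)) n
  (fun i j => box_row I T k i j)) //.
- by rewrite !ltn_ord.
- by move=> s' [sn _] /=; rewrite !sn // N0 kE.
- by move=> s' [sn _] /=; rewrite sn.
- move=> s' i' j' [sn sq] i'n j'n vE1 vE2.
  rewrite run_If beval_BLtN [neval _ _]/= [neval _ _]/= vE1 sn // N0.
  rewrite [nmem s0 _ _]/= /box_row.
  case: ltnP => [i'm|mi'].
    apply: (@run_SumQ _ _ _ _ _ _ _ _ _
      (fun l => mx_entry (qW I) i' l * mx_entry T l j')).
      by move=> s2 [sn2 _] /=; rewrite sn2 // sn.
    move=> s2 l [sn2 sq2] lE ln /=.
    by rewrite lE !sn2 // vE1 vE2 !sq2 // !sq // Q0 // TE'.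
  rewrite run_If beval_BLtN [neval _ _]/= [neval _ _]/= vE1 !sn // N0 kE.
  rewrite [nmem s0 _ _]/=; case: ltnP => [i'k|ki'] /=; rewrite vE1 vE2 ?sn // N0 ?kE ?sq // TE' //=.
    by apply: leq_trans kn; rewrite ltn_subLR.
  by apply: leq_trans kn; rewrite ltn_subLR // -addnA.
Qed.

Variables (k phi : nat).

(* The [i]-th coordinate ranges over one of [phi] intervals, the index of which
   is the [i]-th digit of the index [t] of the box in base [phi]. *)
Definition digit (t i : nat) : nat := ((t %/ phi ^ i) %% phi)%N.

(** [c = 0] gives the lower and [c = 1] the upper end of the selected interval, of length
    [2 r / phi]. *)
Definition bound (t c i : nat) : rat :=
  mx_entry (qa I) i 0 - r%:R + (2 * r * (digit t i + c))%:R * (phi%:R)^-1.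

Definition ebound (i : nexp) (c : nat) : qexp :=
  QAdd (QAdd (q1 6 i) (QOpp (QNat (inp 4))))
    (QMul (QNat (NMul (NMul (NConst 2) (inp 4))
             (NAdd (NMod (NDiv (rd vt) (NGet vpow i)) (rd vphi)) (NConst c))))
          (QInv (QNat (rd vphi)))).

Definition prepared (T : 'M[rat]_n) (s : state) : Prop :=
  [/\ inputs_ok s,
      nmem s vk 0 = k /\ nmem s vphi 0 = phi,
      (forall i, (i <= n)%N -> nmem s vpow i = (phi ^ i)%N),
      (forall i j : 'I_n, qmem s aT i j = T i j) /\
      (forall i : 'I_n, qmem s alin i 0 = lin I i)
    & forall (i : 'I_(m + (k + k))) (j : 'I_n),
        qmem s aW i j = box_row I T k i j].

(** The arrays on which [prepared] depends. As these tests compute, preservation by a concrete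
    command is settled by evaluation. *)
Definition kept_n := [:: 0; vk; vphi; vpow; vn]%N.
Definition kept_q (a : nat) := (a < 7)%N || (a \in [:: aT; aW; alin]%N).

Lemma prepared_off T wn wq s s' : same_off wn wq s s' ->
  ~~ has (fun x => x \in kept_n) wn -> ~~ has kept_q wq ->
  prepared T s -> prepared T s'.
Proof.
move=> ss' nn nq [okI [kE phiE] powE [TE linE] WE].
have [sn sq] := ss'.
have hn b i : b \in kept_n -> nmem s' b i = nmem s b i.
  by move=> bk; apply: sn; apply/negP => bw; move/hasPn: nn => /(_ _ bw); rewrite bk.
have hq b i j : kept_q b -> qmem s' b i j = qmem s b i j.
  by move=> bk; apply: sq; apply/negP => bw; move/hasPn: nq => /(_ _ bw); rewrite bk.
split.
- have [N0 [Nn Q0]] := okI; split; last split.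
  + by move=> i; rewrite hn.
  + by rewrite hn.
  + by move=> a i j a7; rewrite hq ?Q0 // /kept_q a7.
- by rewrite !hn.
- by move=> i iN; rewrite hn // powE.
- by split=> *; rewrite hq.
- by move=> i j; rewrite hq.
Qed.

Lemma qeval_ebound T s t i c ei : prepared T s -> nmem s vt 0 = t ->
  (i < n)%N -> neval s ei = i -> qeval s (ebound ei c) = bound t c i.
Proof.
move=> [[N0 [Nn Q0]] [kE phiE] powE _ _] tE iN eiE.
by rewrite /= eiE tE powE 1?ltnW // phiE N0 Q0.
Qed.

Definition c_rhs : cmd :=
  Fill aw vi rows vj (NConst 1)
    (If (BLtN (rd vi) (inp 3)) (setq atmp (q1 5 (rd vi)))
       (If (BLtN (rd vi) (NAdd (inp 3) (rd vk)))
          (setq atmp (QOpp (ebound (NSub (rd vi) (inp 3)) 0)))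
          (setq atmp (ebound (NSub (rd vi) (NAdd (inp 3) (rd vk))) 1))))
    (q1 atmp (NConst 0)).

Lemma run_rhs T s t : prepared T s -> nmem s vt 0 = t -> (k <= n)%N ->
  forall i : 'I_(m + (k + k)),
    qmem (run c_rhs s) aw i 0 = box_rhs I k (bound t 0) (bound t 1) i.
Proof.
move=> ps tE kn i.
have [[N0 [Nn Q0]] [kE phiE] _ _ _] := ps.
rewrite (@run_Fill _ _ _ _ _ _ _ _ _ _ _ (m + (k + k)) 1
  (fun i _ => box_rhs I k (bound t 0) (bound t 1) i)) //.
- by rewrite ltn_ord.
- by move=> s' [sn _] /=; rewrite !sn // N0 kE.
- move=> s' i' j' ss' i'n j'n vE1 vE2.
  have [sn sq] := ss'; have ps' := prepared_off ss' isT isT ps.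
  have tE' : nmem s' vt 0 = t by rewrite sn.
  rewrite run_If beval_BLtN [neval _ _]/= [neval _ _]/= vE1 sn // N0 /box_rhs.
  rewrite [nmem s0 _ _]/=; case: ltnP => [i'm|mi'].
    by rewrite /= vE1 sq // Q0.
  rewrite run_If beval_BLtN [neval _ _]/= [neval _ _]/= vE1 !sn // N0 kE.
  rewrite [nmem s0 _ _]/=; case: ltnP => [i'k|ki'].
  + have := @qeval_ebound T s' t (i' - m) 0 (NSub (rd vi) (inp 3)) ps' tE'.
    rewrite /= vE1 sn // N0 /= => -> //.
    by apply: leq_trans kn; rewrite ltn_subLR.
  + have := @qeval_ebound T s' t (i' - (m + k)) 1
      (NSub (rd vi) (NAdd (inp 3) (rd vk))) ps' tE'.
    rewrite /= vE1 !sn // N0 kE /= => -> //.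
    by apply: leq_trans kn; rewrite ltn_subLR // -addnA.
Qed.

Definition c_obj : cmd :=
  Fill ao vi (rd vn) vj (NConst 1)
    (SumQ atmp vl (rd vn)
      (QMul (QGet aT (rd vl) (rd vi))
         (QAdd (q1 alin (rd vl))
            (QMul (QGet 0 (rd vl) (rd vl))
                  (QAdd (ebound (rd vl) 0) (ebound (rd vl) 1))))))
    (q1 atmp (NConst 0)).

Lemma run_obj T s t : prepared T s -> nmem s vt 0 = t ->
  forall i : 'I_n, qmem (run c_obj s) ao i 0 = box_obj I T (bound t 0) (bound t 1) i.
Proof.
move=> ps tE i.
have [[N0 [Nn Q0]] [kE phiE] _ [TE linE] _] := ps.
rewrite (@run_Fill _ _ _ _ _ _ _ _ _ _ _ n 1
  (fun i _ => box_obj I T (bound t 0) (bound t 1) i)) //.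
- by rewrite ltn_ord.
- by move=> s' [sn _] /=; rewrite !sn.
- move=> s' i' j' ss' i'n j'n vE1 vE2.
  have [sn sq] := ss'; have ps' := prepared_off ss' isT isT ps.
  apply: (@run_SumQ _ _ _ _ _ _ _ _ _
      (fun l => mx_entry T l i' * secant I (bound t 0) (bound t 1) l)).
    by move=> s2 [sn2 _] /=; rewrite sn2 // sn.
  move=> s2 l ss2 lE ln; have ps2 := prepared_off ss2 isT isT ps'.
  have [sn2 sq2] := ss2.
  have E c := @qeval_ebound T s2 t l c (rd vl) ps2 _ ln lE.
  have tE2 : nmem s2 vt 0 = t by rewrite sn2 // sn.
  have [[_ [_ Q2]] _ _ [T2 lin2] _] := ps2.
  transitivity (qmem s2 aT l i' * (qmem s2 alin l 0 + qmem s2 0 l l *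
    (bound t 0 l + bound t 1 l))).
    rewrite -!E //= lE; congr (qmem _ _ _ _ * _).
    by rewrite sn2.
  rewrite (T2 (Ordinal ln) (Ordinal i'n)) (lin2 (Ordinal ln)) Q2 //.
  by rewrite -mx_entryE.
Qed.

Variable T : 'M[rat]_n.
Local Notation Q t := (box_milp I T k (bound t 0) (bound t 1)).

(** [None] also covers the answer [Unbounded], which a correct solver never gives over a
    polytope. *)
Definition box_sol (t : nat) : option 'cV[rat]_n :=
  match O (Q t) with Optimal x => Some x | _ => None end.

Definition value (y : 'cV[rat]_n) : rat :=
  \sum_(l < n) (quad I l * (y l 0 * y l 0) + lin I l * y l 0).

Definition c_point : cmd :=
  Fill apt vi (rd vn) vj (NConst 1)
    (SumQ atmp vl (rd vn) (QMul (QGet aT (rd vi) (rd vl)) (q1 ax (rd vl))))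
    (q1 atmp (NConst 0)).

Lemma run_point s (x : 'cV[rat]_n) : prepared T s ->
  (forall i : 'I_n, qmem s ax i 0 = x i 0) ->
  forall i : 'I_n, qmem (run c_point s) apt i 0 = (T *m x) i 0.
Proof.
move=> [[N0 [Nn Q0]] _ _ [TE _] _] xE i.
rewrite (@run_Fill _ _ _ _ _ _ _ _ _ _ _ n 1
  (fun i _ => \sum_(l < n) mx_entry T i l * mx_entry x l 0)) //.
- rewrite ltn_ord mxE /=; apply: eq_bigr => l _.
  by rewrite -[0%N]/(val (0 : 'I_1)) !mx_entryE.
- by move=> s' [sn _] /=; rewrite sn.
- move=> s' i' j' [sn sq] i'n _ vE1 vE2.
  apply: (@run_SumQ _ _ _ _ _ _ _ _ _ (fun l => mx_entry T i' l * mx_entry x l 0)).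
  + by move=> s2 [sn2 _] /=; rewrite sn2 // sn.
  + move=> s2 l [sn2 sq2] lE ln /=.
    rewrite lE !sq2 // !sn2 // !sq // vE1.
    rewrite (TE (Ordinal i'n) (Ordinal ln)) (xE (Ordinal ln)).
    by rewrite -!mx_entryE.
Qed.

Definition c_val : cmd :=
  SumQ aval vl (rd vn)
    (QAdd (QMul (QGet 0 (rd vl) (rd vl))
                (QMul (q1 apt (rd vl)) (q1 apt (rd vl))))
          (QMul (q1 alin (rd vl)) (q1 apt (rd vl)))).

Lemma run_val s (y : 'cV[rat]_n) : prepared T s ->
  (forall i : 'I_n, qmem s apt i 0 = y i 0) ->
  qmem (run c_val s) aval 0 0 = value y.
Proof.
move=> [[N0 [Nn Q0]] _ _ [_ linE] _] yE.
rewrite (@run_SumQ _ _ _ _ _ _ _ _ n (fun l => quad I l *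
  (mx_entry y l 0 * mx_entry y l 0) + lin I l * mx_entry y l 0)).
- by apply: eq_bigr => l _; rewrite -[0%N]/(val (0 : 'I_1)) !mx_entryE.
- by move=> s2 [sn2 _] /=; rewrite sn2.
- move=> s2 l [sn2 sq2] lE ln /=.
  rewrite lE !sq2 // (yE (Ordinal ln)) (linE (Ordinal ln)) Q0 //.
  by rewrite -mx_entryE.
Qed.

Definition c_store : cmd :=
  Fill abest vi (rd vn) vj (NConst 1) Skip (q1 apt (rd vi)).

Lemma run_store s : nmem s vn 0 = n ->
  forall i : 'I_n, qmem (run c_store s) abest i 0 = qmem s apt i 0.
Proof.
move=> nE i.
rewrite (@run_Fill _ _ _ _ _ _ _ _ _ _ _ n 1 (fun i _ => qmem s apt i 0)) //.
- by rewrite ltn_ord.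
- by move=> s' [sn _] /=; rewrite sn.
- by move=> s' i' j' [_ sq] _ _ vE1 vE2 /=; rewrite vE1 sq.
Qed.

(** Candidates are compared by the quadratic objective: the values of the MILPs omit the constants
    of the secants, which depend on the box. *)
Definition c_keep : cmd :=
  If (BNot (BAnd (BLeN (NConst 1) (rd vbest))
                 (BLeQ (q1 abval (NConst 0)) (q1 aval (NConst 0)))))
     (Seq (setv vbest (NConst 1)) (Seq (setq abval (q1 aval (NConst 0))) c_store))
     Skip.

Definition c_box : cmd :=
  Seq c_rhs (Seq c_obj (Seq (Solve (rd vn) (inp 2) rows ao aW aw ax)
    (If (BEqN (rd ax) (NConst 1)) (Seq c_point (Seq c_val c_keep)) Skip))).

Definition c_boxes : cmd :=
  Seq (setv vbest (NConst 0)) (For vt (NGet vpow (rd vk)) c_box).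

(** The flag [vbest] is there because no rational in [abval] could stand for plus infinity. *)
Definition best_ok (t : nat) (s : state) : Prop :=
  if nmem s vbest 0 == 0%N then forall t', (t' < t)%N -> box_sol t' = None
  else exists t' x, [/\ (t' < t)%N, box_sol t' = Some x,
    forall i : 'I_n, qmem s abest i 0 = (T *m x) i 0,
    qmem s abval 0 0 = value (T *m x)
    & forall t'' x', (t'' < t)%N -> box_sol t'' = Some x' ->
        value (T *m x) <= value (T *m x')].

Lemma run_keep s t x : nmem s vn 0 = n -> box_sol t = Some x ->
  (forall i : 'I_n, qmem s apt i 0 = (T *m x) i 0) ->
  qmem s aval 0 0 = value (T *m x) ->
  best_ok t s -> best_ok t.+1 (run c_keep s).
Proof.
move=> nE sol ptE valE; rewrite /c_keep run_If.
have store : (forall t'' x', (t'' < t)%N -> box_sol t'' = Some x' ->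
      value (T *m x) <= value (T *m x')) ->
    best_ok t.+1 (run (Seq (setv vbest (NConst 1))
      (Seq (setq abval (q1 aval (NConst 0))) c_store)) s).
  move=> mini; rewrite !run_Seq; set s2 := run (setq _ _) _.
  have f1 : nmem (run c_store s2) vbest 0 = 1%N by rewrite run_frameN.
  rewrite /best_ok f1; exists t, x; split=> //.
  - by move=> i; rewrite run_store //= ptE.
  - by rewrite run_frameQ.
  - move=> t'' x'; rewrite ltnS leq_eqVlt => /orP[/eqP->|]; last exact: mini.
    by rewrite sol => -[<-].
have -> : beval eps s (BNot (BAnd (BLeN (NConst 1) (rd vbest))
    (BLeQ (q1 abval (NConst 0)) (q1 aval (NConst 0))))) =
    ~~ ((0 < nmem s vbest 0)%N && (qmem s abval 0 0 <= qmem s aval 0 0)) by [].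
rewrite lt0n {1}/best_ok; have [f0|f0] := eqVneq (nmem s vbest 0) 0%N => old.
  by apply: store => t'' x' t''t; rewrite old.
have [t' [x1 [t't sol1 bE bv mini]]] := old.
have [le|lt] := leP (qmem s abval 0 0) (qmem s aval 0 0); last first.
  apply: store => t'' x' t''t /(mini _ _ t''t) le'; apply: (le_trans _ le').
  by rewrite -valE -bv ltW.
rewrite /best_ok /= (negPf f0); exists t', x1; split=> //; first exact: ltnW.
move=> t'' x'; rewrite ltnS leq_eqVlt => /orP[/eqP->|]; last exact: mini.
by rewrite sol => -[<-]; rewrite -valE -bv.
Qed.

Lemma best_ok_none t s : box_sol t = None -> best_ok t s -> best_ok t.+1 s.
Proof.
move=> none; rewrite /best_ok; case: eqP => _ old.
  by move=> t'; rewrite ltnS leq_eqVlt => /orP[/eqP->//|/old].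
have [t' [x [t't sol bE bv mini]]] := old.
exists t', x; split=> //; first exact: ltnW.
move=> t'' x'; rewrite ltnS leq_eqVlt => /orP[/eqP->|]; last exact: mini.
by rewrite none.
Qed.

Lemma best_ok_eq t s s' : (forall i, nmem s' vbest i = nmem s vbest i) ->
  (forall a i j, a \in [:: abest; abval] -> qmem s' a i j = qmem s a i j) ->
  best_ok t s -> best_ok t s'.
Proof.
move=> sn sq; rewrite /best_ok sn; case: eqP => // _ [t' [x [? ? bE bv ?]]].
by exists t', x; split=> // [i|]; rewrite sq.
Qed.

Lemma run_box s t : prepared T s -> nmem s vt 0 = t -> (k <= n)%N ->
  best_ok t s ->
  [/\ prepared T (run c_box s), calls (run c_box s) = rcons (calls s) (Q t)
    & best_ok t.+1 (run c_box s)].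
Proof.
move=> ps tE kn bok.
have ps' : prepared T (run c_box s).
  by apply: prepared_off (run_same_off eps O c_box s) _ _ ps.
suff : calls (run c_box s) = rcons (calls s) (Q t) /\ best_ok t.+1 (run c_box s).
  by case.
move=> {ps'}; rewrite /c_box !run_Seq.
set s1 := run c_rhs s; set s2 := run c_obj s1.
have ps1 : prepared T s1 by apply: prepared_off (run_same_off eps O c_rhs s) _ _ ps.
have ps2 : prepared T s2 by apply: prepared_off (run_same_off eps O c_obj s1) _ _ ps1.
have tE1 : nmem s1 vt 0 = t by rewrite run_frameN.
have [[N0 [Nn Q0]] [kE phiE] _ _ rowE] := ps2.
have [||||||] := @run_Solve R eps O s2 (rd vn) (inp 2) rows ao aW aw ax n p
  (m + (k + k)) (\col_j box_obj I T (bound t 0) (bound t 1) j)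
  (\matrix_(i, j) box_row I T k i j)
  (\col_i box_rhs I k (bound t 0) (bound t 1) i).
- exact: Nn.
- by rewrite /= N0.
- by rewrite /= N0 kE.
- by move=> j; rewrite (run_obj ps1 tE1) mxE.
- by move=> i j; rewrite rowE mxE.
- by move=> i; rewrite run_frameQ // (run_rhs ps tE kn) mxE.
set s3 := run _ s2 => c3; rewrite -/(box_milp I T k (bound t 0) (bound t 1)) => sol.
have ps3 : prepared T s3.
  by apply: prepared_off (run_same_off eps O (Solve (rd vn) (inp 2) rows ao aW aw ax) s2) _ _ ps2.
have bok3 : best_ok t s3.
  apply: best_ok_eq bok => [i|a i j].
    by rewrite !run_frameN.
  by rewrite !inE => /orP[/eqP->|/eqP->]; rewrite !run_frameQ.
have calls3 : calls s3 = rcons (calls s) (Q t) by rewrite c3 !run_calls.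
split; first by rewrite run_calls.
rewrite run_If beval_BEqN [neval _ _]/= [neval _ _]/=.
move: sol; case OQ : (O _) => [x||] sol; last 2 first.
- by rewrite (negPf sol); apply: best_ok_none; rewrite // /box_sol OQ.
- by rewrite (negPf sol); apply: best_ok_none; rewrite // /box_sol OQ.
have [-> xE] := sol; rewrite eqxx.
have solt : box_sol t = Some x by rewrite /box_sol OQ.
set s4 := run c_point s3; set s5 := run c_val s4.
have ps4 : prepared T s4 by apply: prepared_off (run_same_off eps O c_point s3) _ _ ps3.
have ptE := run_point ps3 xE.
rewrite !run_Seq; apply: (@run_keep s5 t x) => //.
- by rewrite !run_frameN //; have [[_ []]] := ps.
- by move=> i; rewrite run_frameQ.
- exact: run_val.
- apply: best_ok_eq bok3 => [i|a i j]; first by rewrite !run_frameN.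
  by rewrite !inE => /orP[/eqP->|/eqP->]; rewrite !run_frameQ.
Qed.

(** Every box costs exactly one call, even one without feasible points. *)
Lemma run_boxes s : prepared T s -> (k <= n)%N ->
  let s' := run c_boxes s in
  [/\ prepared T s', calls s' = calls s ++ [seq Q t | t <- iota 0 (phi ^ k)]
    & best_ok (phi ^ k) s'].
Proof.
move=> ps kn; rewrite /c_boxes run_Seq; set s1 := run _ s.
have ps1 : prepared T s1.
  by apply: prepared_off (run_same_off eps O (setv vbest (NConst 0)) s) _ _ ps.
apply: (run_For (P := fun t s' => [/\ prepared T s',
    calls s' = calls s ++ [seq Q t | t <- iota 0 t] & best_ok t s'])) => //.
- by have [_ [kE phiE] powE _ _] := ps; rewrite /= kE powE.
- by split=> //; rewrite cats0.
move=> t s' _ _ tE [ps' cE bok].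
have [ps2 cE2 bok2] := run_box ps' tE kn bok; split=> //.
by rewrite cE2 cE -[t.+1]addn1 iotaD map_cat catA cats1.
Qed.

(** The output convention reuses the array of [D], so this has to come last. *)
Definition c_output : cmd :=
  Fill 0 vi (rd vn) vj (NConst 1) Skip (q1 abest (rd vi)).

Lemma run_output s : nmem s vn 0 = n ->
  forall i : 'I_n, qmem (run c_output s) 0 i 0 = qmem s abest i 0.
Proof.
move=> nE i.
rewrite (@run_Fill _ _ _ _ _ _ _ _ _ _ _ n 1 (fun i _ => qmem s abest i 0)) //.
- by rewrite ltn_ord.
- by move=> s' [sn _] /=; rewrite sn.
- by move=> s' i' j' [_ sq] _ _ vE1 vE2 /=; rewrite vE1 sq.
Qed.

End Assembly.

(** * The complete program *)

Section Program.
Variables (R : realType) (eps : R) (O : milp_solver).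
Local Notation run := (run eps O).
Variables (d e p m : nat) (I : miqp d e p m) (r : nat).
Local Notation n := (d + e)%N.
Local Notation s0 := (init_state I r).

(** The text of the program depends on [eps] only through [M]; the tolerance itself is consulted by
    the test [BEps] in the search for [phi]. *)
Definition program (M : nat) : cmd :=
  Seq (setv vn (NAdd (inp 0) (inp 1))) (Seq c_rank (Seq (c_phi M)
  (Seq c_pow (Seq c_id (Seq c_exch (Seq c_coord_mx (Seq c_lin
  (Seq c_row (Seq c_boxes c_output))))))))).

Definition quad_rank : nat := (\sum_(i < d) (quad I i != 0%R))%N.

Lemma quad_rank_d : (quad_rank <= d)%N.
Proof.
rewrite -[X in (_ <= X)%N]card_ord -sum1_card.
by apply: leq_sum => i _; case: eqP.
Qed.

Lemma quad_rank_le : (quad_rank <= n)%N.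
Proof. exact: leq_trans quad_rank_d (leq_addr _ _). Qed.

Lemma run_program M : \rank (qB I) = p ->
  fine_enough eps r quad_rank (4 * M * (r * quad_rank)) ->
  exists phi X,
    let T := coord_mx I X in
    let s := run (program M) s0 in
    [/\ exchanged (mx_entry (qB I)) p X,
      fine_enough eps r quad_rank phi,
      forall j, (j < phi)%N -> ~~ fine_enough eps r quad_rank j,
      calls s = [seq box_milp I T quad_rank (bound I r phi t 0) (bound I r phi t 1)
                | t <- iota 0 (phi ^ quad_rank)]
    & exists2 s1, best_ok O I r quad_rank phi T (phi ^ quad_rank) s1
        & forall i : 'I_n, qmem s 0 i 0 = qmem s1 abest i 0].
Proof.
move=> rB fM.
have pd : (p <= d)%N by rewrite -rB rank_leq_row.
have pn : (p <= n)%N by apply: leq_trans pd (leq_addr _ _).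
rewrite /program 10!run_Seq.
set s1 := run (setv _ _) _; set s2 := run c_rank s1; set s3 := run (c_phi M) s2.
set s4 := run c_pow s3; set s5 := run c_id s4; set s6 := run c_exch s5.
set s7 := run c_coord_mx s6; set s8 := run c_lin s7; set s9 := run c_row s8.
set s10 := run c_boxes s9.
have ok1 : inputs_ok I r s1 by do 2![split=> //].
have ok2 : inputs_ok I r s2.
  by apply: inputs_ok_off (run_same_off eps O c_rank s1) _ _ ok1.
have ok3 : inputs_ok I r s3.
  by apply: inputs_ok_off (run_same_off eps O (c_phi M) s2) _ _ ok2.
have ok4 : inputs_ok I r s4.
  by apply: inputs_ok_off (run_same_off eps O c_pow s3) _ _ ok3.
have ok5 : inputs_ok I r s5.
  by apply: inputs_ok_off (run_same_off eps O c_id s4) _ _ ok4.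
have ok6 : inputs_ok I r s6.
  by apply: inputs_ok_off (run_same_off eps O c_exch s5) _ _ ok5.
have ok7 : inputs_ok I r s7.
  by apply: inputs_ok_off (run_same_off eps O c_coord_mx s6) _ _ ok6.
have ok8 : inputs_ok I r s8.
  by apply: inputs_ok_off (run_same_off eps O c_lin s7) _ _ ok7.
have ok9 : inputs_ok I r s9.
  by apply: inputs_ok_off (run_same_off eps O c_row s8) _ _ ok8.
have k2 : nmem s2 vk 0 = quad_rank.
  by rewrite /s2 run_rank; apply: eq_bigr.
have r2 : nmem s2 0 4 = r by have [->] := ok2.
have := @run_phi R eps O M s2; rewrite k2 r2 => /(_ fM).
rewrite -/s3; set phi := nmem s3 vphi 0 => -[fine mini].
have nE s : inputs_ok I r s -> nmem s vn 0 = n by move=> [_ []].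
have pow4 i : (i <= n)%N -> nmem s4 vpow i = (phi ^ i)%N.
  by move=> ni; rewrite /s4 run_pow // nE.
have id5 (i j : 'I_n) : qmem s5 aX i j = (1%:M : 'M[rat]_n) i j.
  by have := @run_id R eps O s4; rewrite (nE _ ok4) => ->.
have [X [exX XE]] : exists X : 'M[rat]_n, exchanged (mx_entry (qB I)) p X /\
    forall i j : 'I_n, qmem s6 aX i j = X i j.
  apply: run_exch => //; first exact: nE.
  - by have [->] := ok5.
  - by have [_ [_ q5]] := ok5; move=> i j; rewrite q5.
  - by apply: mx_entry_free => //; apply: leq_addr.
have TE := run_coord_mx eps O ok6 XE; rewrite -/s7 in TE.
have linE := run_lin eps O ok7; rewrite -/s8 in linE.
have [n2 q2] := run_same_off eps O c_rank s1.
have [n3 q3] := run_same_off eps O (c_phi M) s2.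
have [n4 q4] := run_same_off eps O c_pow s3.
have [n5 q5] := run_same_off eps O c_id s4.
have [n6 q6] := run_same_off eps O c_exch s5.
have [n7 q7] := run_same_off eps O c_coord_mx s6.
have [n8 q8] := run_same_off eps O c_lin s7.
have [n9 q9] := run_same_off eps O c_row s8.
have T8 (i j : 'I_n) : qmem s8 aT i j = coord_mx I X i j by rewrite q8.
have k8 : nmem s8 vk 0 = quad_rank.
  by rewrite n8 // n7 // n6 // n5 // n4 // n3.
have rowE := run_row eps O ok8 k8 quad_rank_le T8; rewrite -/s9 in rowE.
have phi3 : nmem s3 vphi 0 = phi by [].
have calls9 : calls s9 = [::].
  by rewrite run_calls // run_calls // run_calls // run_calls // run_calls //
    run_calls // run_calls // run_calls.
move: n2 n3 n4 n5 n6 n7 n8 n9 q2 q3 q4 q5 q6 q7 q8 q9.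
rewrite -/s2 -/s3 -/s4 -/s5 -/s6 -/s7 -/s8 -/s9.
clearbody s9; clearbody s8; clearbody s7; clearbody s6; clearbody s5.
clearbody s4; clearbody phi; clearbody s3; clearbody s2; clearbody s1.
move=> n2 n3 n4 n5 n6 n7 n8 n9 q2 q3 q4 q5 q6 q7 q8 q9.
have prep : prepared I r quad_rank phi (coord_mx I X) s9.
  split=> //.
  - by rewrite n9 // k8 n9 // n8 // n7 // n6 // n5 // n4.
  - by move=> i ni; rewrite n9 // n8 // n7 // n6 // n5 // pow4.
  - by split=> [i j|i]; rewrite q9.
have [prep10 calls10 best10] := run_boxes eps O prep quad_rank_le.
exists phi, X; split=> //.
- by rewrite run_calls // calls10 calls9.
- exists s10 => // i; apply: run_output.
  by have [[_ []]] := prep10.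
Qed.

End Program.

(** * Encoding sizes *)

(** A measure additive under products and, up to one bit, under sums; it agrees with [rat_size] up
    to a factor 2 and a constant. *)
Definition bits (b : nat) (x : rat) : bool :=
  (`|numq x| <= 2 ^ b)%N && (`|denq x| <= 2 ^ b)%N.

(** The fraction need not be in lowest terms. From [numq x * c = a * denq x] and coprimality the
    reduced denominator divides [c], and then the numerator cannot exceed [a] in absolute value. *)
Lemma bits_frac b (x : rat) (a : int) (c : nat) : (0 < c)%N ->
  x = a%:~R / c%:R -> (`|a| <= 2 ^ b)%N -> (c <= 2 ^ b)%N -> bits b x.
Proof.
move=> c0 xE ab cb.
have E : numq x * c%:Z = a * denq x.
  apply: (@intr_inj rat); rewrite !intrM -pmulrn; apply/eqP.
  rewrite -eqr_div ?divq_num_den ?xE // ?intr_eq0 ?denq_neq0 //.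
  by rewrite pnatr_eq0 -lt0n.
have En : (`|numq x| * c = `|a| * `|denq x|)%N.
  by have := congr1 absz E; rewrite !abszM.
have dc : (`|denq x| %| c)%N.
  rewrite -(@Gauss_dvdr _ `|numq x|) ?En ?dvdn_mull //.
  by rewrite coprime_sym coprime_num_den.
have ldc : (`|denq x| <= c)%N by apply: dvdn_leq.
rewrite /bits (leq_trans ldc cb) andbT; apply: leq_trans ab.
by rewrite -(leq_pmul2r c0) En leq_mul2l ldc orbT.
Qed.

Lemma bits_rat_size b x : bits b x -> (rat_size x <= 2 * b + 3)%N.
Proof.
move=> /andP[nb db]; rewrite /rat_size.
have up y : (y <= 2 ^ b)%N -> (up_log 2 y.+1 <= b.+1)%N.
  move=> yb; apply: up_log_min => //; rewrite expnS mul2n -addnn.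
  by rewrite -add1n leq_add // expn_gt0.
have := up _ nb; have := up _ db; lia.
Qed.

Lemma rat_size_bits b x : (rat_size x <= b)%N -> bits b x.
Proof.
rewrite /rat_size /bits => h.
have pow y : (up_log 2 y.+1 <= b)%N -> (y <= 2 ^ b)%N.
  move=> yb; apply: (@leq_trans (2 ^ up_log 2 y.+1)); last by rewrite leq_exp2l.
  by apply: ltnW; apply: up_logP.
by apply/andP; split; apply: pow; lia.
Qed.

Lemma bits_le b b' x : (b <= b')%N -> bits b x -> bits b' x.
Proof.
move=> bb' /andP[nb db]; have bb : (2 ^ b <= 2 ^ b')%N by rewrite leq_exp2l.
by rewrite /bits (leq_trans nb bb) (leq_trans db bb).
Qed.

Lemma bits_nat b (c : nat) : (c <= 2 ^ b)%N -> bits b c%:R.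
Proof.
move=> cb; apply: (@bits_frac _ _ c 1); rewrite ?divr1 ?expn_gt0 //.
Qed.

Lemma bits0 b : bits b 0.
Proof. exact: (@bits_nat b 0). Qed.

Lemma bits1 b : bits b 1.
Proof. by apply: (@bits_nat b 1); rewrite expn_gt0. Qed.

Lemma bitsN b x : bits b x -> bits b (- x).
Proof. by rewrite /bits numqN denqN abszN. Qed.

Lemma denq_absz x : (`|denq x|%N)%:R = (denq x)%:~R :> rat.
Proof. by rewrite pmulrn absz_denq. Qed.

Lemma ratE x : x = (numq x)%:~R / (`|denq x|%N)%:R.
Proof. by rewrite denq_absz divq_num_den. Qed.

Lemma absz_denq_gt0 x : (0 < `|denq x|)%N.
Proof. by rewrite absz_gt0 denq_neq0. Qed.

Lemma bitsM a b x y : bits a x -> bits b y -> bits (a + b) (x * y).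
Proof.
move=> /andP[nx dx] /andP[ny dy].
apply: (@bits_frac _ _ (numq x * numq y) (`|denq x| * `|denq y|)).
- by rewrite muln_gt0 !absz_denq_gt0.
- by rewrite {1}(ratE x) {1}(ratE y) natrM intrM mulf_div.
- by rewrite abszM expnD leq_mul.
- by rewrite expnD leq_mul.
Qed.

Lemma bitsD a b x y : bits a x -> bits b y -> bits (a + b + 1) (x + y).
Proof.
move=> /andP[nx dx] /andP[ny dy].
apply: (@bits_frac _ _ (numq x * denq y + numq y * denq x)
  (`|denq x| * `|denq y|)).
- by rewrite muln_gt0 !absz_denq_gt0.
- rewrite {1}(ratE x) {1}(ratE y) addf_div ?pnatr_eq0 -?lt0n ?absz_denq_gt0 //.
  by rewrite natrM intrD !intrM !denq_absz.
- have : (`|(numq x * denq y + numq y * denq x)%R|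
       <= `|numq x| * `|denq y| + `|numq y| * `|denq x|)%N.
    by rewrite -!abszM; lia.
  move=> h; apply: (leq_trans h); rewrite !expnD expn1 muln2 -addnn.
  by apply: leq_add; [exact: leq_mul | rewrite mulnC; exact: leq_mul].
- by rewrite expnD (leq_trans _ (leq_pmulr _ _)) // expnD leq_mul.
Qed.

Lemma bitsV b x : bits b x -> bits b x^-1.
Proof.
have [->|x0] := eqVneq x 0; first by rewrite invr0.
have -> : x^-1 = (denq x)%:~R / (numq x)%:~R.
  by rewrite -[in LHS](divq_num_den x) invf_div.
have cop : coprime `|denq x| `|numq x| by rewrite coprime_sym coprime_num_den.
rewrite /bits coprimeq_num // coprimeq_den // numq_eq0 (negPf x0).
by rewrite abszM absz_sg numq_eq0 x0 mul1n absz_id andbC.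
Qed.

Lemma bits_sum b n (f : 'I_n -> rat) : (forall i, bits b (f i)) ->
  bits (n * (b + 1)) (\sum_i f i).
Proof.
elim: n f => [|n IH] f fb; first by rewrite big_ord0 bits0.
rewrite big_ord_recr mulSn addnC addnA /=.
by apply: bitsD => //; apply: IH.
Qed.

(** [k * k] bits for the [k!] terms of the Leibniz formula, and for each of the [k] factors of a
    term [b] bits of a numerator plus [b * (k * k)] bits of the product of all denominators. *)
Definition det_bits (k b : nat) : nat := (k * k + k * (b + b * (k * k)))%N.

Lemma leq_absz_sum (J : finType) (f : J -> int) c :
  (forall i, (`|f i| <= c)%N) -> (`|(\sum_i f i)%R| <= #|J| * c)%N.
Proof.
move=> fc; rewrite -lez_nat abszE.
apply: (le_trans (ler_norm_sum _ _ _)).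
rewrite -sum1_card big_distrl /= -[Posz _]natz natr_sum.
by apply: ler_sum => i _; rewrite mul1n natz -abszE lez_nat.
Qed.

Lemma absz_prod (J : finType) (f : J -> int) :
  `|(\prod_i f i)%R|%N = (\prod_i `|f i|)%N.
Proof. exact: (big_morph absz abszM erefl). Qed.

Lemma leq_prod_const (J : finType) (f : J -> nat) c :
  (forall i, (f i <= c)%N) -> (\prod_i f i <= c ^ #|J|)%N.
Proof.
move=> fc; rewrite -prod_nat_const; elim/big_ind2: _ => // x1 y1 x2 y2.
exact: leq_mul.
Qed.

(** With [Dl] the product of all denominators, [N = Dl A] is an integer matrix and the determinant
    of [A] is that of [N] over [Dl ^ k]. *)
Lemma bits_det k b (A : 'M[rat]_k) : (forall i j, bits b (A i j)) ->
  bits (det_bits k b) (\det A).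
Proof.
move=> Ab.
pose Dl := (\prod_(ij : 'I_k * 'I_k) `|denq (A ij.1 ij.2)|)%N.
pose N : 'M[int]_k :=
  \matrix_(i, j) (numq (A i j) * (Dl %/ `|denq (A i j)|)%N%:Z).
have Dl0 : (0 < Dl)%N by rewrite prodn_gt0 // => ij; apply: absz_denq_gt0.
have Dlb : (Dl <= 2 ^ (b * (k * k)))%N.
  rewrite expnM -[X in (_ ^ X)%N](_ : #|{: 'I_k * 'I_k}| = _).
    by apply: leq_prod_const => ij; case/andP: (Ab ij.1 ij.2).
  by rewrite card_prod card_ord.
have AE : A = (Dl%:R)^-1 *: map_mx intr N.
  apply/matrixP => i j; rewrite !mxE {1}(ratE (A i j)) intrM -pmulrn.
  have dv : (`|denq (A i j)| %| Dl)%N.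
    by rewrite /Dl (bigD1 (i, j)) //= dvdn_mulr.
  rewrite natf_div //.
  have : Dl%:R != 0 :> rat by rewrite pnatr_eq0 -lt0n.
  have : `|denq (A i j)|%:R != 0 :> rat by rewrite pnatr_eq0 -lt0n absz_denq_gt0.
  move: (_%:~R) (_%:R) (Dl%:R) => x y z y0 z0.
  by field; rewrite y0.
have Nb : (`|\det N| <= 2 ^ det_bits k b)%N.
  rewrite /determinant.
  apply: (leq_trans (leq_absz_sum (c := (2 ^ (b + b * (k * k))) ^ k) _)).
    move=> s; rewrite abszMsign absz_prod -[X in (_ <= _ ^ X)%N]card_ord.
    apply: leq_prod_const => i; rewrite mxE abszM expnD.
    apply: leq_mul; first by case/andP: (Ab i (s i)).
    exact: leq_trans (leq_div _ _) Dlb.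
  rewrite /det_bits [X in (_ <= X)%N]expnD; apply: leq_mul; last by rewrite -expnM mulnC.
  rewrite card_Sn; apply: (@leq_trans (k ^ k)).
    by rewrite fact_prod big_add1 big_mkord -[X in (_ <= _ ^ X)%N]card_ord; apply: leq_prod_const => i.
  rewrite expnM; case: (k) => // k'; rewrite leq_exp2r //.
  by apply/ltnW/ltn_expl.
rewrite AE detZ det_map_mx mulrC.
apply: (@bits_frac _ _ (\det N) (Dl ^ k)) => //.
- by rewrite expn_gt0 Dl0.
- by rewrite natrX exprVn.
- rewrite /det_bits; apply: (@leq_trans ((2 ^ (b * (k * k))) ^ k)).
    by case: (k) Dlb => // k' Dlb'; rewrite leq_exp2r.
  by rewrite -expnM leq_exp2l //; nia.
Qed.

Lemma det_bits_le k k' b : (k <= k')%N -> (det_bits k b <= det_bits k' b)%N.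
Proof. by move=> kk; rewrite /det_bits leq_add ?leq_mul ?leq_add ?leq_mul. Qed.

(** Cramer's rule: an entry of the inverse is, up to sign, a minor of order [k - 1] over the
    determinant. *)
Lemma bits_invmx k b (A B : 'M[rat]_k) : A *m B = 1%:M ->
  (forall i j, bits b (A i j)) -> forall i j, bits (2 * det_bits k b) (B i j).
Proof.
move=> AB Ab i j.
have uA : A \in unitmx by have [] := mulmx1_unit AB.
have -> : B = invmx A by rewrite -[LHS](mulKmx uA) AB mulmx1.
rewrite /invmx uA !mxE mul2n -addnn; apply: bitsM.
  exact/bitsV/bits_det.
rewrite /cofactor.
have : bits (det_bits k b) (\det (row' j (col' i A))).
  apply: bits_le (bits_det _); first by apply: det_bits_le; apply: leq_pred.
  by move=> i' j'; rewrite !mxE.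
by case: (odd (j + i)) / (boolP (odd (j + i))) => o h;
  rewrite -signr_odd ?(negPf o) ?o ?expr1 ?expr0 ?mulN1r ?mul1r //; apply: bitsN.
Qed.

Lemma bits_mx_entry m n (A : 'M[rat]_(m, n)) b i j :
  (mx_size A <= b)%N -> bits b (mx_entry A i j).
Proof.
move=> Ab; rewrite /mx_entry; case: insubP => [i' _ _|_]; last exact: bits0.
case: insubP => [j' _ _|_]; last exact: bits0.
apply/rat_size_bits/(leq_trans _ Ab); rewrite /mx_size.
rewrite (bigD1 i') //= (bigD1 j') //=; lia.
Qed.

Lemma mx_size_le m n (A : 'M[rat]_(m, n)) b : (forall i j, bits b (A i j)) ->
  (mx_size A <= m * n * (2 * b + 4))%N.
Proof.
move=> Ab; rewrite /mx_size.
have -> : (m * n * (2 * b + 4) = m * n + \sum_(i < m) \sum_(j < n) (2 * b + 3))%N.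
  by rewrite !sum_nat_const !card_ord; lia.
rewrite leq_add2l; apply: leq_sum => i _; apply: leq_sum => j _.
exact: bits_rat_size.
Qed.

(** Arguing on [M] instead of the successive pivots gives a bound that does not grow with their
    number. *)
Lemma bits_exchanged n b p c (X : 'M[rat]_n) : exchanged b p X ->
  (forall i j, bits c (b i j)) -> forall i j, bits (2 * det_bits n c) (X i j).
Proof.
move=> [M [MX Mb M01]] bc; apply: bits_invmx MX _ => i j.
have [ip|pi] := ltnP i p; first by rewrite Mb.
by have /orP[/eqP->|/eqP->] := M01 i j pi; [exact: bits0|exact: bits1].
Qed.

(** * Size of the MILPs *)

Section MilpSize.
Variables (S rb fb : nat).
Local Open Scope nat_scope.

(** [S] is the size of the instance, so [2 * S] bounds [d + e]; the last summand covers the columns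
    taken from the lattice basis. *)
Definition coord_bits := 2 * det_bits (2 * S) S + S.
(** The terms follow [bound]: [a_i], [r], the numerator [2 r (digit + c)], and the division by
    [phi]. *)
Definition bound_bits := S + rb + 1 + (1 + rb + fb + fb) + 1.
Definition secant_bits := S + (S + (bound_bits + bound_bits + 1)) + 1.
(** A sum instead of a maximum, to dominate all kinds of entries at once and stay polynomial. *)
Definition entry_bits := 2 * S * (coord_bits + secant_bits + 1)
  + 2 * S * (S + coord_bits + 1) + coord_bits + bound_bits.
Definition milp_size_bound :=
  1 + 2 * S * (2 * entry_bits + 4) + 3 * S * (2 * S) * (2 * entry_bits + 4)
  + 3 * S * (2 * entry_bits + 4).
End MilpSize.

(** This form also covers [phi = 0], where [t < phi ^ k] forces [t = 0] and the digit is 0 by the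
    conventions for division. *)
Lemma digit_le phi k t i : (t < phi ^ k)%N -> (digit phi t i <= phi.-1)%N.
Proof.
move=> tk; rewrite /digit; case: phi tk => [|phi] tk.
  have -> : t = 0%N by case: k tk => [|k]; rewrite ?expn0 ?exp0n // ltnS leqn0 => /eqP.
  by rewrite div0n.
by rewrite -ltnS ltn_pmod.
Qed.

Section MilpSizeBound.
Variables (d e p m : nat) (I : miqp d e p m) (r phi k rb fb : nat).
Local Notation n := (d + e)%N.
Local Notation S := (miqp_size I).
(** The sizes of the columns [c], [l] and [w] count their entries. *)
Lemma miqp_dims : [/\ (d <= S)%N, (e <= S)%N & (m <= S)%N].
Proof.
by rewrite /miqp_size /mx_size !muln1; split; lia.
Qed.

Lemma miqp_entries i j : [/\ bits S (mx_entry (qD I) i j),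
  bits S (mx_entry (qc I) i j), bits S (mx_entry (ql I) i j),
  bits S (mx_entry (qB I) i j) & [/\ bits S (mx_entry (qW I) i j),
  bits S (mx_entry (qw I) i j) & bits S (mx_entry (qa I) i j)]].
Proof.
by split; [..|split]; apply: bits_mx_entry; rewrite /miqp_size; lia.
Qed.

Variable X : 'M[rat]_n.
Hypothesis (exX : exchanged (mx_entry (qB I)) p X).
Hypotheses (kd : (k <= d)%N) (r_le : (r <= 2 ^ rb)%N) (phi_le : (phi <= 2 ^ fb)%N).

Let b_entry i j : bits S (mx_entry (qB I) i j).
Proof. by case: (miqp_entries i j). Qed.

Lemma bits_coord i j : bits (coord_bits S) (mx_entry (coord_mx I X) i j).
Proof.
have [dS eS _] := miqp_dims.
rewrite /mx_entry; case: insubP => [i' _ _|_]; last exact: bits0.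
case: insubP => [j' _ _|_]; last exact: bits0.
rewrite mxE; case: ifP => _.
  by apply: bits_le (b_entry _ _); rewrite /coord_bits; lia.
apply: bits_le (bits_exchanged exX b_entry _ _); rewrite /coord_bits.
by apply: leq_trans (leq_addr _ _); rewrite leq_mul2l det_bits_le //; lia.
Qed.

Lemma bits_bound t c i : (t < phi ^ k)%N -> (c <= 1)%N ->
  bits (bound_bits S rb fb) (bound I r phi t c i).
Proof.
move=> tk c1; have dig := digit_le i tk.
have [_ _ _ _ [_ _ ba]] := miqp_entries i 0.
apply: bitsD; first by apply: bitsD => //; apply/bitsN/bits_nat.
apply: bitsM; last by apply/bitsV/bits_nat.
apply: bits_nat; rewrite !expnD expn1; apply: leq_mul; first by rewrite leq_mul2l.
have [p0|p0] := posnP phi; first by move: dig; rewrite p0 /= leqn0 => /eqP ->; rewrite (leq_trans c1) // expn_gt0.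
by apply: (leq_trans _ phi_le); lia.
Qed.

Lemma bits_secant t i : (t < phi ^ k)%N ->
  bits (secant_bits S rb fb) (secant I (bound I r phi t 0) (bound I r phi t 1) i).
Proof.
move=> tk; apply: bitsD.
  rewrite /lin; case: ifP => _; first by case: (miqp_entries i 0).
  by case: (miqp_entries (i - d) 0).
apply: bitsM; first by case: (miqp_entries i i).
by apply: bitsD; apply: bits_bound.
Qed.

Lemma box_milp_size t : (t < phi ^ k)%N ->
  (milp_size (box_milp I (coord_mx I X) k (bound I r phi t 0) (bound I r phi t 1))
   <= milp_size_bound S rb fb)%N.
Proof.
move=> tk; have [dS eS mS] := miqp_dims.
have n2 : (n <= 2 * S)%N by lia.
have r3 : (m + (k + k) <= 3 * S)%N by lia.
have T i j : bits (coord_bits S) (mx_entry (coord_mx I X) i j) := bits_coord i j.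
have Eo : forall (j : 'I_n) (i : 'I_1), bits (entry_bits S rb fb)
    ((\col_j box_obj I (coord_mx I X) (bound I r phi t 0) (bound I r phi t 1) j : 'cV_n) j i).
  move=> j i; rewrite mxE; apply: (@bits_le (n * (coord_bits S + secant_bits S rb fb + 1))).
    rewrite /entry_bits -!addnA; apply: leq_trans (leq_addr _ _).
    by apply: leq_mul; rewrite ?addnA.
  by apply: bits_sum => l; apply: bitsM => //; apply: bits_secant.
have EW : forall (i : 'I_(m + (k + k))) (j : 'I_n), bits (entry_bits S rb fb)
    ((\matrix_(i, j) box_row I (coord_mx I X) k i j : 'M_(_, n)) i j).
  move=> i j; rewrite mxE /box_row; case: ifP => _.
    apply: (@bits_le (n * (S + coord_bits S + 1))).
      have : (n * (S + coord_bits S + 1) <= 2 * S * (S + coord_bits S + 1))%N by rewrite leq_mul.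
      by rewrite /entry_bits; lia.
    by apply: bits_sum => l; apply: bitsM => //; case: (miqp_entries i l) => _ _ _ _ [].
  apply: (@bits_le (coord_bits S)); first by rewrite /entry_bits; lia.
  by case: ifP => _; rewrite ?bitsN.
have Ew : forall (i : 'I_(m + (k + k))) (j : 'I_1), bits (entry_bits S rb fb)
    ((\col_i box_rhs I k (bound I r phi t 0) (bound I r phi t 1) i : 'cV_(_)) i j).
  move=> i j; rewrite mxE /box_rhs; case: ifP => _.
    apply: (@bits_le S); last by case: (miqp_entries i 0) => _ _ _ _ [].
    by rewrite /entry_bits /coord_bits; lia.
  apply: (@bits_le (bound_bits S rb fb)); first by rewrite /entry_bits; lia.
  by case: ifP => _; rewrite ?bitsN ?bits_bound.
apply: leq_add; first apply: leq_add; first apply: leq_add => //.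
- by apply: leq_trans (mx_size_le Eo) _; rewrite muln1; apply: leq_mul.
- by apply: leq_trans (mx_size_le EW) _; apply: leq_mul => //; apply: leq_mul.
- by apply: leq_trans (mx_size_le Ew) _; rewrite muln1; apply: leq_mul.
Qed.

End MilpSizeBound.

(** * Polynomial bounds *)

Definition is_poly (F : nat -> nat) : Prop :=
  exists q : {poly nat}, forall x, F x = q.[x].

Lemma is_poly_const c : is_poly (fun=> c).
Proof. by exists c%:P => x; rewrite hornerC. Qed.

Lemma is_poly_id : is_poly id.
Proof. by exists 'X => x; rewrite hornerX. Qed.

Lemma is_polyD F G : is_poly F -> is_poly G -> is_poly (fun x => F x + G x)%N.
Proof. by move=> [q qE] [q' q'E]; exists (q + q') => x; rewrite hornerD qE q'E. Qed.

Lemma is_polyM F G : is_poly F -> is_poly G -> is_poly (fun x => F x * G x)%N.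
Proof. by move=> [q qE] [q' q'E]; exists (q * q') => x; rewrite hornerM qE q'E. Qed.

Lemma horner_nat_le (q : {poly nat}) x y : (x <= y)%N -> (q.[x] <= q.[y])%N.
Proof.
move=> xy; rewrite !horner_coef.
elim/big_ind2: _ => // [a b c c' ab cc|i _]; first exact: leq_add.
rewrite leq_mul //; elim: (val i) => // k IH; rewrite !exprS.
exact: leq_mul.
Qed.

(** The last argument bounds the bits of [phi <= 4 M r k]: 2 for the factor 4, [M] for [M], [q.[S]]
    for [r] and [2 * S] for [k]. *)
Lemma milp_size_poly (q : {poly nat}) M :
  is_poly (fun S => milp_size_bound S q.[S] (2 + M + q.[S] + 2 * S)).
Proof.
have qP : is_poly (fun S => q.[S]) by exists q.
rewrite /milp_size_bound /entry_bits /secant_bits /bound_bits /coord_bits /det_bits.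
repeat first [exact: is_poly_const | exact: is_poly_id | exact: qP |
  apply: is_polyD | apply: is_polyM].
Qed.

(** * Correctness *)

Lemma In_map (A : eqType) (B : Type) (f : A -> B) (s : seq A) y :
  List.In y (map f s) -> exists2 x, x \in s & y = f x.
Proof.
elim: s => //= x s IH [<-|/IH[x' x's ->]]; first by exists x; rewrite ?mem_head.
by exists x' => //; rewrite inE x's orbT.
Qed.

(** Base [phi] representation, built from the most significant digit by Horner's scheme. *)
Lemma digit_onto phi k (f : nat -> nat) : (forall i, (i < k)%N -> (f i < phi)%N) ->
  exists2 t, (t < phi ^ k)%N & forall i, (i < k)%N -> digit phi t i = f i.
Proof.
elim: k f => [|k IH] f fp; first by exists 0%N.
have [|t tk tE] := IH (fun i => f i.+1); first by move=> i ik; apply: fp.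
have f0 : (f 0%N < phi)%N by apply: fp.
have p0 : (0 < phi)%N by apply: leq_ltn_trans f0.
exists (t * phi + f 0%N)%N.
  rewrite expnSr; apply: (@leq_trans (t.+1 * phi)); first by rewrite mulSn addnC ltn_add2r.
  by rewrite leq_mul2r tk orbT.
case=> [_|i ik]; first by rewrite /digit expn0 divn1 modnMDl modn_small.
by rewrite /digit expnS divnMA divnMDl // (divn_small f0) addn0 -/(digit _ _ _) tE.
Qed.

(** * Consequences of the spherical form *)

Section Geometry.
Variables (R : realType) (d e p m : nat) (I : miqp d e p m) (r : nat).
Local Notation n := (d + e)%N.
Hypothesis sfI : spherical_form R I r.

Lemma rank_quad : \rank (qD I) = quad_rank I.
Proof.
have [diagD _ _ _ _] := sfI; rewrite mxrank_diag //.
by apply: eq_bigr => i _; rewrite /quad mx_entryE.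
Qed.

(** If entry [i] were nonzero, sortedness would make the entries 0 to [i] nonzero, which is more
    than the rank allows. *)
Lemma quad_sorted (i : 'I_n) : (quad_rank I <= i)%N -> quad I i = 0.
Proof.
have [_ sortD _ _ _] := sfI.
have [di|id_] := leqP d i; first by rewrite quad_ge.
apply: contraTeq => qi; rewrite -ltnNge /quad_rank.
have h (j : 'I_d) : (j < i.+1)%N -> quad I j != 0.
  rewrite ltnS => /(sortD j (Ordinal id_)); rewrite /quad -[val i]/(val (Ordinal id_)).
  move: qi; rewrite /quad -[val i]/(val (Ordinal id_)) !mx_entryE.
  by rewrite -!normr_gt0 => q0; apply: lt_le_trans.
rewrite (bigID (fun j : 'I_d => (j < i.+1)%N)) /=; apply: leq_trans (leq_addr _ _).
rewrite (eq_bigr (fun=> 1%N)) => [|j /h ->//].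
by rewrite (big_ord_narrow id_) sum1_card card_ord.
Qed.

(** The point at distance 1 from the center along the first axis lies in the unit ball, hence in the
    ball of radius [r]. *)
Lemma radius_gt0 : (0 < d)%N -> (0 < r)%N.
Proof.
move=> d0; have [_ _ _ _ [b1 br]] := sfI.
pose i0 := Ordinal d0; pose u : 'cV[R]_d := delta_mx i0 0.
have E : dotp u u = 1.
  rewrite /dotp (bigD1 i0) //= big1 ?addr0; first by rewrite mxE !eqxx mulr1.
  by move=> i ii; rewrite mxE (negPf ii) mul0r.
have : ball2 (center R I) 1 (center R I + u).
  by rewrite /ball2 /= addrC addKr E sqrtr1.
move=> /b1 /br; rewrite /ball2 /= addrC addKr E sqrtr1.
by case: (r) => //; rewrite ler10.
Qed.

Lemma coord_in_ball (x : 'cV[R]_n) (i : 'I_n) : polytope_of I x ->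
  (i < d)%N -> `|x i 0 - ratr (mx_entry (qa I) i 0)| <= r%:R.
Proof.
move=> Px id_; have [_ _ _ _ [_ br]] := sfI.
have : ball2 (center R I) r%:R (usubmx x).
  by apply: br; exists (dsubmx x); rewrite vsubmxK.
have -> : mx_entry (qa I) i 0 = qa I (Ordinal id_) 0 by rewrite -mx_entryE.
rewrite /ball2 /= => h; apply: le_trans h; rewrite -sqrtr_sqr ler_wsqrtr //.
rewrite /dotp (bigD1 (Ordinal id_)) //= !mxE.
have -> : lshift e (Ordinal id_) = i by apply: val_inj.
rewrite expr2 lerDl; apply: sumr_ge0 => j _; rewrite -expr2; exact: sqr_ge0.
Qed.

End Geometry.

Lemma interval_cover (R : realFieldType) (lo w y : R) (phi : nat) :
  (0 < phi)%N -> lo <= y <= lo + w * phi%:R ->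
  exists2 j, (j < phi)%N & lo + w * j%:R <= y <= lo + w * (j + 1)%:R.
Proof.
elim: phi => // -[|phi] IH _ /andP[ly yu].
  by exists 0%N => //; rewrite mulr0 addr0 ly.
have [yl|lty] := leP y (lo + w * phi.+1%:R).
  have [//||j jp jE] := IH; first by rewrite ly.
  by exists j => //; apply: ltnW.
by exists phi.+1 => //; rewrite (ltW lty) addn1.
Qed.

(** * Accuracy of the best solution *)

Section Approximation.
Variables (R : realType) (eps : R) (d e p m : nat) (I : miqp d e p m) (r : nat).
Local Notation n := (d + e)%N.
Hypotheses (eps_gt0 : 0 < eps) (sfI : spherical_form R I r).
Local Notation k := (quad_rank I).

(** At [phi = 4 M r k] the right-hand side is [48 eps M^2 r^2 k^2], while [eps M >= 1] and
    [k <= k^2]. *)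
Lemma fine_enough_grid M : eps^-1 <= M%:R :> R ->
  fine_enough eps r k (4 * M * (r * k)).
Proof.
move=> eM; rewrite /fine_enough.
have eM1 : 1 <= eps * M%:R by rewrite -ler_pdivrMl // mulr1.
have kk : (k <= k * k)%N by case: (k) => // k'; rewrite leq_pmulr.
have M0 : (0 < M)%N.
  by rewrite lt0n; apply: contraTneq eM1 => ->; rewrite mulr0 ler10.
apply: (@le_trans _ _ (16 * (r * r * (k * k)))%:R).
  by rewrite ler_nat !leq_mul.
have -> : (3 * (4 * M * (r * k) * (4 * M * (r * k))) =
  M * (3 * M * (16 * (r * r * (k * k)))))%N by nia.
rewrite [in leRHS]natrM mulrA -[leLHS]mul1r ler_pM ?ler01 ?ler0n //.
by rewrite ler_nat leq_pmull // muln_gt0 M0.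
Qed.

Lemma grid_ceil phi : fine_enough eps r k phi ->
  (forall j, (j < phi)%N -> ~~ fine_enough eps r k j) ->
  Num.ceil (4 * r%:R * Num.sqrt (k%:R / (3 * eps))) = phi.
Proof.
move=> fine mini; set x := 4 * _ * _.
have e3 : 0 < 3 * eps by rewrite mulr_gt0.
have x0 : 0 <= x by rewrite !mulr_ge0 ?sqrtr_ge0.
have x2 : x ^+ 2 * (3 * eps) = (16 * (r * r * k))%:R.
  rewrite exprMn sqr_sqrtr ?divr_ge0 ?ler0n ?ltW // -mulrA mulfVK ?gt_eqF //.
  by rewrite !natrM; ring.
have fineE j : fine_enough eps r k j = (x <= j%:R).
  rewrite -(@ler_pXn2r _ 2) // ?nnegrE ?ler0n // -(ler_pM2r e3) x2.
  by rewrite /fine_enough; congr (_ <= _); rewrite !natrM; ring.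
apply: ceil_def; rewrite -fineE fine andbT intrB.
(* For [phi = 0] the strict lower bound of the ceiling is -1, below [0 <= x]. *)
case: phi fine mini => [|j] _ mini; first by apply: lt_le_trans x0; rewrite sub0r ltrN10.
by rewrite -[j.+1]addn1 PoszD intrD addrK; have := mini j (ltnSn _); rewrite fineE -ltNge.
Qed.

Variables (phi : nat) (O : milp_solver) (X : 'M[rat]_n).
Hypothesis O_ok : solver_ok R O.
Hypotheses (rB : \rank (qB I) = p) (exX : exchanged (mx_entry (qB I)) p X).
Hypothesis fine : fine_enough eps r k phi.
Local Notation T := (coord_mx I X).

Let pn : (p <= n)%N.
Proof. by rewrite -{1}rB (leq_trans (rank_leq_row _)) ?leq_addr. Qed.

(** For [k = 0] the grid size may be 0, but then [phi ^ k = 1] and the only box imposes no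
    bounds. *)
Lemma grid_gt0 : (0 < k)%N -> (0 < phi)%N.
Proof.
move=> k0; have r0 := radius_gt0 sfI (leq_trans k0 (quad_rank_d I)).
rewrite lt0n; apply: contraTneq fine => ->.
by rewrite /fine_enough muln0 mulr0 lern0 -lt0n !muln_gt0 r0 k0.
Qed.

Lemma ratr_bound t c i : ratr (bound I r phi t c i) =
  ratr (mx_entry (qa I) i 0) - r%:R + 2 * r%:R / phi%:R * (digit phi t i + c)%:R :> R.
Proof.
by rewrite /bound !(rmorphD, rmorphM, rmorphN, fmorphV) /= !ratr_nat; ring.
Qed.

Lemma in_some_box (y : 'cV[R]_n) : polytope_of I y ->
  exists2 t, (t < phi ^ k)%N &
    in_box k (bound I r phi t 0) (bound I r phi t 1) y.
Proof.
move=> Py.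
(* The statement is vacuous for [i >= k], so that choice yields a total function of naturals. *)
have cover (i : nat) : exists j, forall ik : (i < k)%N, forall i' : 'I_n, i' = i :> nat ->
  (j < phi)%N /\
  ratr (mx_entry (qa I) i 0) - r%:R + 2 * r%:R / phi%:R * j%:R <= y i' 0
   <= ratr (mx_entry (qa I) i 0) - r%:R + 2 * r%:R / phi%:R * (j + 1)%:R.
  have [ik|] := boolP (i < k)%N; last by exists 0%N.
  have id_ : (i < d)%N := leq_trans ik (quad_rank_d I).
  have ie : (i < n)%N by rewrite ltn_addr.
  have p0 := grid_gt0 (leq_ltn_trans (leq0n _) ik).
  have := coord_in_ball sfI Py (i := Ordinal ie) id_; rewrite ler_norml => /andP[yl yu].
  have [|j jp jE] := @interval_cover R (ratr (mx_entry (qa I) i 0) - r%:R)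
    (2 * r%:R / phi%:R) (y (Ordinal ie) 0) phi p0.
    rewrite mulfVK ?pnatr_eq0 -?lt0n //; move: yl yu => /=; lra.
  exists j => _ i' i'E; split=> //.
  by have -> : i' = Ordinal ie by apply: val_inj.
have [f fE] := choice cover.
have fp i : (i < k)%N -> (f i < phi)%N.
  move=> ik; have ie : (i < n)%N by rewrite ltn_addr // (leq_trans ik) ?(quad_rank_d I).
  by have [] := fE i ik (Ordinal ie) erefl.
have [t tk tE] := digit_onto fp.
exists t => // i ik; rewrite !ratr_bound tE // addn0.
by have [_ ->] := fE i ik i erefl.
Qed.

Lemma ratr_value (y : 'cV[rat]_n) :
  objective I (map_mx ratr y : 'cV[R]_n) = ratr (value I y).
Proof.
have [diagD _ _ _ _] := sfI.
rewrite objectiveE // raddf_sum; apply: eq_bigr => i _.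
by rewrite /= rmorphD !rmorphM !mxE expr2.
Qed.

(** Intervals of length [2 r / phi] give the error [|D_ii| (r / phi)^2] in each coordinate. The
    variation bounds [|D_ii|] by [16 / 3] of itself, and the choice of [phi] bounds [k (r / phi)^2]
    by [3 eps / 16]. *)
Lemma secant_error (yp ym : 'cV[R]_d) (xmin xmax : 'cV[R]_n) t :
  aligned I yp ym -> minimizer I xmin -> maximizer I xmax ->
  \sum_(i < n | (i < k)%N) `|ratr (quad I i)| *
      ratr (bound I r phi t 1 i - bound I r phi t 0 i) ^+ 2 / 4
    <= eps * (objective I xmax - objective I xmin).
Proof.
move=> al mn mx; have spread := aligned_spread sfI al mn mx.
have gap0 : 0 <= objective I xmax - objective I xmin.
  by rewrite subr_ge0; case: mn => _; apply; case: mx.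
move: spread gap0; set gap := _ - objective I xmin => spread gap0.
have [k0|k0] := posnP k.
  by rewrite big_pred0 => [|i]; rewrite ?k0 // mulr_ge0 // ltW.
have p0 : 0 < phi%:R :> R by rewrite ltr0n grid_gt0.
pose W : R := r%:R ^+ 2 / phi%:R ^+ 2.
have W0 : 0 <= W by rewrite divr_ge0 // exprn_ge0.
apply: (@le_trans _ _ (\sum_(i < n | (i < k)%N) 16 / 3 * gap * W)).
  apply: ler_sum => i _; rewrite rmorphB /= !ratr_bound.
  have -> : ratr (mx_entry (qa I) i 0) - r%:R + 2 * r%:R / phi%:R *
      (digit phi t i + 1)%:R - (ratr (mx_entry (qa I) i 0) - r%:R +
      2 * r%:R / phi%:R * (digit phi t i + 0)%:R) = 2 * (r%:R / phi%:R) :> R.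
    by rewrite !natrD; ring.
  have -> : `|ratr (quad I i)| * (2 * (r%:R / phi%:R)) ^+ 2 / 4 =
      `|ratr (quad I i)| * W :> R.
    by rewrite /W; move: (`|_|) => q; field; rewrite gt_eqF.
  by apply: ler_wpM2r => //; have := spread i; lra.
rewrite (big_ord_narrow (quad_rank_le I)) sumr_const card_ord -mulr_natr.
have kW : k%:R * W <= 3 / 16 * eps.
  have := fine; rewrite /fine_enough !natrM => h.
  rewrite /W mulrA ler_pdivrMr ?exprn_gt0 //; lra.
have := ler_wpM2l gap0 kW; lra.
Qed.

(** The minimizer lies in some box [t0]; the solution of its MILP is already accurate enough, and
    the stored point is at least as good. *)
Lemma best_approx (yp ym : 'cV[R]_d) s (out : 'cV[R]_n) : aligned I yp ym ->
  best_ok O I r k phi T (phi ^ k) s ->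
  (forall i : 'I_n, out i 0 = ratr (qmem s 17 i 0)) ->
  (exists x : 'cV[R]_n, eps_approx I eps x) -> eps_approx I eps out.
Proof.
move=> al best outE [_ [_ [xmin [xmax [mn mx _]]]]].
have [[Pmin Lmin] _] := mn; have [_ mxle] := mx.
have kn := quad_rank_le I.
have ans t := box_milp_answer (bound I r phi t 0) (bound I r phi t 1)
  pn exX kn (quad_sorted sfI) sfI O_ok.
have [t0 t0k box0] := in_some_box Pmin.
have [x0 sol0 val0] : exists2 x0 : 'cV[rat]_n, box_sol O I r k phi T t0 = Some x0 &
  ratr (value I (T *m x0)) <= objective I xmin + eps * (objective I xmax - objective I xmin).
  have := ans t0; rewrite /box_sol; case: (O _) => [x [_ /(_ xmin (conj Pmin Lmin) box0)]|/(_ xmin (conj Pmin Lmin))|//].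
    move=> le; exists x => //; rewrite -ratr_value; apply: (le_trans le).
    by rewrite lerD2l; apply: secant_error al mn mx.
  by move=> /(_ box0).
(* The flag cannot be zero, because box [t0] has a solution. *)
have := ans; move: best; rewrite /best_ok; case: eqP => _.
  by move=> /(_ _ t0k); rewrite sol0.
move=> [t1 [x1 [t1k sol1 bE _ mini]]] _.
have outT : out = map_mx ratr (T *m x1).
  by apply/colP => i; rewrite outE bE [in RHS]mxE.
have := ans t1; move: sol1; rewrite /box_sol; case: (O _) => // x [->] [Fx _].
rewrite outT; split=> //; exists xmin, xmax; split=> //.
rewrite lerBlDl; apply: le_trans val0; rewrite ratr_value ler_rat.
exact: mini sol0.
Qed.

End Approximation.

(** The program is chosen from [eps] alone, the polynomial from [eps] and the size bound on [r];
    neither depends on the instance or the solver. *)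
Theorem proposition3 (R : realType) (r : nat -> nat) (r_size : poly_sized r)
    (eps : R) (eps_gt0 : 0 < eps) (eps_le1 : eps <= 1) :
  exists (alg : cmd) (q : {poly nat}),
  forall (d e p m : nat) (I : miqp d e p m),
    spherical_form R I (r d) ->
    (exists yp ym : 'cV[R]_d, aligned I yp ym) ->
  forall O : milp_solver, solver_ok R O ->
  let s := run eps O alg (init_state I (r d)) in
  [/\ (exists x : 'cV[R]_(d + e), eps_approx I eps x) ->
        eps_approx I eps (output R (d + e) s),
      (size (calls s))%:Z <=
        Num.ceil (4 * (r d)%:R * Num.sqrt ((\rank (qD I))%:R / (3 * eps)))
          ^+ \rank (qD I)
    & forall Q, List.In Q (calls s) ->
        [/\ mvars Q = (d + e)%N, mint Q = p
          & (milp_size Q <= q.[miqp_size I])%N]].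
Proof.
have [q0 q0E] := r_size.
pose M := Num.bound eps^-1.
have eM : eps^-1 <= M%:R :> R by apply/ltW/archi_boundP; rewrite invr_ge0 ltW.
have [q qE] := milp_size_poly q0 M.
exists (program M), q => d e p m I sfI [yp [ym al]] O O_ok.
have [_ _ rB _ _] := sfI.
have [phi [X H]] :=
  @run_program R eps O d e p m I (r d) M rB (fine_enough_grid I (r d) eps_gt0 eM).
move: H; cbv zeta; set s := run _ _ _ _.
move=> [exX fine mini callsE [s1 best outE]]; split.
- apply: (best_approx eps_gt0 sfI O_ok rB exX fine al best) => i.
  by rewrite mxE outE.
- rewrite callsE size_map size_iota (rank_quad sfI).
  by rewrite (grid_ceil eps_gt0 fine mini) -[leLHS]natz natrX natz.
- move=> Q; rewrite callsE => inQ; have [t] := @In_map nat _ _ _ _ inQ.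
  move=> /[swap] ->; rewrite mem_iota /= add0n => tk.
  split=> //; rewrite -qE.
  have [dS _ _] := miqp_dims I.
  have kd := (quad_rank_d I).
  have q0le := horner_nat_le q0 dS.
  have r_le : (r d <= 2 ^ q0.[miqp_size I])%N.
    apply: (@leq_trans (2 ^ up_log 2 (r d).+1)); first exact/ltnW/up_logP.
    by rewrite leq_exp2l // (leq_trans _ q0le) // (leq_trans _ (q0E d)) // leq_addl.
  apply: (box_milp_size exX kd r_le _ tk).
  (* [phi] is minimal, and [4 M r k] is already fine enough. *)
  have phiM : (phi <= 4 * M * (r d * quad_rank I))%N.
    by rewrite leqNgt; apply/negP => /mini; rewrite fine_enough_grid.
  apply: (leq_trans phiM); rewrite !expnD -mulnA -mulnA -mulnA.
  apply: leq_mul => //; apply: leq_mul; first exact/ltnW/ltn_expl.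
  apply: leq_mul => //; apply: leq_trans (ltnW (ltn_expl _ (isT : 1 < 2)%N)) _.
  by rewrite leq_exp2l //; lia.
Qed.
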